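(* Let $\Omega\subset\mathbb{C}^n$ be a B-regular domain, and let $\Omega'\subset\Omega$ be a relatively compact subdomain with the property that for each $p\in\partial\Omega'$ there exists a ball $B\subset\Omega'$ with $p\in\partial B$. Let $h\in C(\bar\Omega)$ and $u\in\mathcal{PSH}(\Omega)$ be such that $u\le h$, and assume that $u$ is continuous on $\bar\Omega'$. Then the Perron--Bremermann envelope $P(h_{u,\Omega'})$ of $$h_{u,\Omega'}(z):=\begin{cases}u(z) & \text{if } z\in\bar\Omega',\\ h(z) & \text{if } z\in\Omega\setminus\bar\Omega'\end{cases}$$ is continuous.
   Context: $\mathcal{PSH}(\Omega)$ is the set of plurisubharmonic functions on $\Omega$. A bounded domain $\Omega\subset\mathbb{C}^n$ is B-regular if every $\phi\in C(\partial\Omega)$ extends to a function in $\mathcal{PSH}(\Omega)\cap C(\bar\Omega)$. The Perron--Bremermann envelope of a function $f$ on $\Omega$ is $P(f)(z)=\sup\{v(z) : v\in\mathcal{PSH}(\Omega),\ v\le f \text{ on } \Omega\}$, $z\in\Omega$. *)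

(* Defs.v *)
From HB Require Import structures.
From mathcomp Require Import all_boot all_order all_algebra.
From mathcomp Require Import all_classical all_reals all_analysis.
From mathcomp Require Export complex.

Set Implicit Arguments.
Unset Strict Implicit.
Unset Printing Implicit Defensive.

Import Order.TTheory GRing.Theory Num.Theory.
Import numFieldNormedType.Exports.

Local Open Scope classical_set_scope.
Local Open Scope ring_scope.
Local Open Scope complex_scope.

(* The regular module R[i]^o, unlike R[i] itself, carries the topology of the
   modulus; row vectors over it then carry the product topology. *)
Notation Cplx R := (R[i]^o)%type (only parsing).
Notation Cvec R n := ('rV[R[i]^o]_n)%type (only parsing).

Local Notation normc := ComplexField.Normc.normc.

Section Topology.
Context {T : topologicalType}.

Definition bdry (A : set T) : set T := closure A `\` A°.

Definition domain (A : set T) : Prop := [/\ open A, connected A & A !=set0].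

(* A is relatively compact in B *)
Definition relatively_compact (A B : set T) : Prop :=
  compact (closure A) /\ closure A `<=` B.

End Topology.

Section Functions.
Context {R : realType} {T : topologicalType}.
Implicit Types (A : set T) (f : T -> \bar R).

Definition upper_semicontinuous_on A f : Prop :=
  forall z, A z -> forall a : R, (f z < a%:E)%E ->
    \forall w \near within A (nbhs z), (f w < a%:E)%E.

(* f belongs to C(A): its restriction to A is real-valued and continuous. *)
Definition continuous_real_on A f : Prop :=
  (forall z, A z -> f z \is a fin_num) /\ {within A, continuous (fine \o f)}.

End Functions.

Section ComplexSpace.
Context {R : realType}.

Definition circle_point (a : Cplx R) (r t : R) : Cplx R :=
  a + ((r * cos t) +i* (r * sin t)).

Definition closed_disc (a : Cplx R) (r : R) : set (Cplx R) :=
  [set w | normc (w - a) <= r].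

(* The function identically -oo counts as subharmonic and as plurisubharmonic,
   and a function is only constrained on the set where it is considered.
   Integrands below are bounded above, so the integral is never of the form
   +oo - +oo, but it may be -oo. *)
Definition subharmonic (U : set (Cplx R)) (v : Cplx R -> \bar R) : Prop :=
  [/\ forall z, U z -> (v z < +oo)%E,
      upper_semicontinuous_on U v &
      forall (a : Cplx R) (r : R), 0 < r -> closed_disc a r `<=` U ->
        (v a <= ((2 * pi)^-1)%:E *
          \int[lebesgue_measure]_(t in `[0%R, (2 * pi)%R])
            v (circle_point a r t))%E].

Context {n : nat}.
Implicit Types (Omega : set (Cvec R n)) (v f u : Cvec R n -> \bar R).

Definition plurisubharmonic Omega v : Prop :=
  [/\ forall z, Omega z -> (v z < +oo)%E,
      upper_semicontinuous_on Omega v &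
      forall a b : Cvec R n,
        subharmonic [set l : Cplx R | Omega (a + l *: b)]
                    (fun l : Cplx R => v (a + l *: b))].

Definition euclidean_norm (z : Cvec R n) : R :=
  Num.sqrt (\sum_(i < n) normc (z 0 i) ^+ 2).

Definition euclidean_ball (c : Cvec R n) (r : R) : set (Cvec R n) :=
  [set z | euclidean_norm (z - c) < r].

Definition bounded Omega : Prop :=
  exists M : R, forall z, Omega z -> euclidean_norm z <= M.

Definition B_regular Omega : Prop :=
  [/\ domain Omega, bounded Omega &
      forall phi : Cvec R n -> R, {within bdry Omega, continuous phi} ->
        exists v : Cvec R n -> R,
          [/\ plurisubharmonic Omega (EFin \o v),
              {within closure Omega, continuous v} &
              forall z, bdry Omega z -> v z = phi z]].

Definition interior_ball_condition Omega : Prop :=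
  forall p, bdry Omega p ->
    exists (c : Cvec R n) (r : R),
      [/\ 0 < r, euclidean_ball c r `<=` Omega & bdry (euclidean_ball c r) p].

Definition Perron_Bremermann Omega f : Cvec R n -> \bar R :=
  fun z => ereal_sup [set v z | v in
    [set v | plurisubharmonic Omega v /\
             forall w, Omega w -> (v w <= f w)%E]].

Definition glued (h : Cvec R n -> R) u Omega' : Cvec R n -> \bar R :=
  fun z => if z \in closure Omega' then u z else (h z)%:E.

End ComplexSpace.

(* Main.v *)
(** Let K be the closure of Omega', F the glued function and P its envelope, so
    that u <= P <= F <= h and P = u on K. The upper regularization of P is
    plurisubharmonic. It equals u in Omega', and because a ball is not thin at its
    boundary points the interior ball condition extends this to all of K. Hence
    it is at most F, so it is P itself, and P is upper semicontinuous.
    B-regularity yields a plurisubharmonic psi < 0 with zero boundary values, and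
    a boundary extension v of h; then v + C psi - e <= F for large C, so P is close
    to h near the boundary of Omega. As in Walsh's argument, max(P, P(. + w) - 5 e)
    inside, glued to P near the boundary, competes in the definition of P for all
    small w, which makes P uniformly continuous. Gluing only gives the mean value
    inequality on small discs, from which the inequality on all discs is deduced
    by averaging over rotations. *)

Require Import Defs.
From HB Require Import structures.
From mathcomp Require Import all_boot all_order all_algebra.
From mathcomp Require Import all_classical all_reals all_analysis.
From mathcomp Require Import measurable_realfun ring lra.

Set Implicit Arguments.
Unset Strict Implicit.
Unset Printing Implicit Defensive.

Import Order.TTheory GRing.Theory Num.Theory.
Import numFieldNormedType.Exports.

Local Open Scope classical_set_scope.
Local Open Scope ring_scope.

Local Notation normc := ComplexField.Normc.normc.
Local Notation Re := complex.Re.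
Local Notation Im := complex.Im.

(** * Coordinates and semicontinuity *)

Section Coordinates.
Context {R : realType}.

(** The obstacle is the boundary of Omega'. There F may jump up from u to h, so it need not be upper
    semicontinuous, and P <= F alone does not keep the regularization of P below F; elsewhere
    continuity of u or of h does. The same jump threatens the translation argument, because z + w
    may leave K while z lies in it. What saves it is that P is already known to be upper
    semicontinuous and equal to u on the compact set K, whence P(z + w) <= u(z) + e for all small w.
    This is why upper semicontinuity has to be settled before lower semicontinuity. The functions
    averaged over circles are bounded above but may take the value -oo. They are handled through M -
    f, which is nonnegative, so that Fatou, Tonelli and translation invariance apply to it.
    Strictness in the maximum principles comes from the square of a real part, whose circle means
    are explicit. *)

Lemma normcD_le (x y : R[i]) : normc (x + y) <= normc x + normc y.
Proof. exact: le_normcD. Qed.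

Lemma normc_ge0 (x : R[i]) : (0 : R) <= normc x.
Proof. by case: x => a b; rewrite /= sqrtr_ge0. Qed.

Lemma normc_distC (x y : R[i]) : normc (x - y) = normc (y - x).
Proof. by rewrite -normcN opprB. Qed.

Lemma normc_real (x : R) : normc x%:C%C = `|x|.
Proof. by rewrite /= expr0n /= addr0 sqrtr_sqr. Qed.

Lemma normc_Re (x : R[i]) : `|Re x| <= normc x.
Proof.
by case: x => a b /=; rewrite -sqrtr_sqr ler_sqrt ?addr_ge0 ?sqr_ge0// lerDl sqr_ge0.
Qed.

Lemma norm_normc (x : R[i]) : `|x| = (normc x)%:C%C.
Proof. by rewrite normc_def; case: x. Qed.

(** Balls of [R[i]^o] have radii in [R[i]], and [0 < e] there forces [e] to be real; its real part
    then serves as an ordinary radius. *)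
Lemma nbhs_normcP (z : Cplx R) (A : set (Cplx R)) :
  nbhs z A <-> exists2 e : R, 0 < e & forall w, normc (w - z) < e -> A w.
Proof.
split.
  move=> /nbhs_ballP [e /= e0 sA].
  have eE : e = (Re e)%:C%C by rewrite RRe_real// realE ltW.
  move: e0; rewrite {1}eE ltcR => e0; exists (Re e) => // w wz.
  by apply: sA; rewrite /ball /= eE norm_normc ltcR normc_distC.
move=> [e e0 sA]; apply/nbhs_ballP; exists e%:C%C; first by rewrite /= ltcR.
move=> w; rewrite /ball /= norm_normc ltcR => wz; apply: sA.
by rewrite normc_distC.
Qed.

Lemma continuous_complex : continuous (fun p : R * R => (p.1 +i* p.2)%C : Cplx R).
Proof.
move=> p A0 /nbhs_normcP [e e0 eA].
have e20 : 0 < e / 2 by rewrite divr_gt0.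
exists (ball p.1 (e / 2), ball p.2 (e / 2)).
  by split; exact: nbhsx_ballx.
move=> q [/= q1 q2]; apply: eA.
rewrite (_ : _ - _ = (q.1 - p.1)%:C%C + (0 +i* (q.2 - p.2))%C); last first.
  by apply/eqP; rewrite eq_complex /= addr0 add0r !eqxx.
apply: (le_lt_trans (normcD_le _ _)); rewrite (splitr e) ltrD//.
  by rewrite normc_real distrC.
by rewrite /= expr0n /= add0r sqrtr_sqr distrC.
Qed.

Lemma continuous_Re : continuous (fun a : Cplx R => Re a).
Proof.
move=> a B /nbhs_ballP [e /= e0 eB].
apply/nbhs_normcP; exists e => // w wa; apply: eB; apply: le_lt_trans wa.
rewrite normc_distC.
by apply: le_trans (normc_Re _); case: (a) (w) => [x y] [x' y'].
Qed.

Lemma continuous_affine {T : topologicalType} (a : Cplx R) (f g : T -> Cplx R) :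
  continuous f -> continuous g -> continuous (fun z => a + f z * g z).
Proof.
move=> cf cg z.
have H1 : (f \* g) @ z --> f z * g z by apply: cvgM; [exact: cf|exact: cg].
have H0 : (cst a : T -> Cplx R) @ z --> a by exact: cvg_cst.
exact: (cvgD H0 H1).
Qed.

Lemma compact_normc_le (M : R) : compact [set a : Cplx R | normc a <= M].
Proof.
have cI : compact (`[- M, M] `*` `[- M, M] : set (R * R)).
  by apply: compact_setX; exact: segment_compact.
have cfI := continuous_compact (continuous_subspaceT continuous_complex) cI.
apply: (subclosed_compact _ cfI).
  rewrite -openC openE => a /= /negP; rewrite -ltNge => Ma.
  apply/nbhs_normcP; exists (normc a - M); first by rewrite subr_gt0.
  move=> w wa /=; apply/negP; rewrite -ltNge.
  have := normcD_le (a - w) w; rewrite subrK normc_distC => aw.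
  by lra.
move=> a /= Ma; exists (Re a, Im a); last by case: a {Ma}.
have aM := le_trans (normc_Re a) Ma.
have bM : `|Im a| <= M.
  apply: le_trans Ma; case: (a) => x y /=.
  by rewrite -sqrtr_sqr ler_sqrt ?addr_ge0 ?sqr_ge0// lerDr sqr_ge0.
by move: aM bM; rewrite !ler_norml /= !in_itv /=.
Qed.

Context {n : nat}.

(** The balls of the product topology, but with real radii. The balls and the boundedness in the
    statement refer to the Euclidean norm instead. *)
Definition polydisc (z : Cvec R n) (e : R) : set (Cvec R n) :=
  [set w | forall i, normc (w 0 i - z 0 i) < e].

Lemma polydisc_center (z : Cvec R n) (e : R) : 0 < e -> polydisc z e z.
Proof. by move=> e0 i; rewrite subrr ComplexField.Normc.normc0. Qed.

Lemma polydisc_sym (z w : Cvec R n) (e : R) : polydisc z e w -> polydisc w e z.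
Proof. by move=> zw i; rewrite normc_distC. Qed.

Lemma polydisc_trans (x y z : Cvec R n) (e d : R) :
  polydisc x e y -> polydisc y d z -> polydisc x (e + d) z.
Proof.
move=> xy yz i; rewrite (_ : z 0 i - x 0 i = (z 0 i - y 0 i) + (y 0 i - x 0 i)).
  by apply: (le_lt_trans (normcD_le _ _)); rewrite addrC ltrD.
by rewrite addrA subrK.
Qed.

Lemma polydisc_le (z w : Cvec R n) (e d : R) :
  e <= d -> polydisc z e w -> polydisc z d w.
Proof. by move=> ed zw i; apply: lt_le_trans ed. Qed.

Lemma nbhs_polydiscP (z : Cvec R n) (A : set (Cvec R n)) :
  nbhs z A <-> exists2 e : R, 0 < e & polydisc z e `<=` A.
Proof.
split.
  move=> /nbhs_ballP [e /= e0 sA].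
  have eE : e = (Re e)%:C%C by rewrite RRe_real// realE ltW.
  have := e0; rewrite {1}eE ltcR => e0'; exists (Re e) => // w wz.
  apply: sA; split => // i j; rewrite ord1.
  by rewrite /ball /= eE norm_normc ltcR normc_distC.
move=> [e e0 sA]; apply/nbhs_ballP; exists e%:C%C; first by rewrite /= ltcR.
move=> w [_ zw]; apply: sA => j; have := zw 0 j.
by rewrite /ball /= norm_normc ltcR normc_distC.
Qed.

(** A Lebesgue number argument: half of the local radius is spent on going from the centre to [x],
    half on going from [x] to [y]. The relation [S] is abstract because it serves uniform
    continuity, room inside an open set, and a one-sided bound on the envelope. *)
Lemma compact_uniform (K : set (Cvec R n)) (S : Cvec R n -> Cvec R n -> Prop) :
  compact K ->
  (forall z, K z -> exists2 e : R, 0 < e &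
     forall x y, polydisc z e x -> polydisc z e y -> S x y) ->
  exists2 e : R, 0 < e & forall x y, K x -> polydisc x e y -> S x y.
Proof.
move=> /compact_near_coveringP cK loc.
have /cK : forall x, K x -> \forall x' \near x & e \near (0:R)^'+,
    forall y, polydisc x' e y -> S x' y.
  move=> z Kz; have [e e0 eS] := loc z Kz.
  have e20 : 0 < e / 2 by rewrite divr_gt0.
  near=> x' d => /= y x'y; apply: eS.
    have : polydisc z (e / 2) x' by near: x'; apply/nbhs_polydiscP; exists (e / 2).
    by apply: polydisc_le; lra.
  rewrite (splitr e); apply: (@polydisc_trans _ x').
    by near: x'; apply/nbhs_polydiscP; exists (e / 2).
  apply: polydisc_le x'y; near: d; exact: nbhs_right_le.
move=> near0; near (0:R)^'+ => e.
by exists e => // x y Kx; move: x Kx y; near: e.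
Unshelve. all: by end_near. Qed.

Lemma bounded_closed_compactC (A : set (Cvec R n)) (M : R) :
  (forall z, A z -> forall i, normc (z 0 i) <= M) -> closed A -> compact A.
Proof.
move=> bA cA.
suff: compact [set z : Cvec R n | forall i, [set a : Cplx R | normc a <= M] (z ord0 i)].
  by move=> cK; apply: (subclosed_compact cA cK) => z Az i; exact: bA.
by apply: (@rV_compact _ n (fun=> [set a : Cplx R | normc a <= M])) => _; exact: compact_normc_le.
Qed.

Lemma within_continuousP (A : set (Cvec R n)) (f : Cvec R n -> R) :
  {within A, continuous f} <-> forall z, A z -> forall e, 0 < e ->
    exists2 d : R, 0 < d & forall w, A w -> polydisc z d w -> `|f w - f z| < e.
Proof.
split.
  move=> cf z Az e e0; have /subspace_continuousP /(_ z Az) := cf.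
  move=> /cvgrPdist_lt /(_ e e0) /= /nbhs_polydiscP [d d0 dA].
  by exists d => // w Aw zw; rewrite distrC; exact: (dA w zw Aw).
move=> H; apply/subspace_continuousP => z Az; apply/cvgrPdist_lt => e e0.
have [d d0 dA] := H z Az e e0.
by apply/nbhs_polydiscP; exists d => // w zw Aw /=; rewrite distrC; exact: dA.
Qed.

Lemma uscP (A : set (Cvec R n)) (f : Cvec R n -> \bar R) :
  upper_semicontinuous_on A f <-> forall z, A z -> forall a : R, (f z < a%:E)%E ->
    exists2 d : R, 0 < d & forall w, A w -> polydisc z d w -> (f w < a%:E)%E.
Proof.
split=> H z Az a fa.
  have /nbhs_polydiscP [d d0 dA] := H z Az a fa.
  by exists d => // w Aw zw; exact: (dA w zw Aw).
have [d d0 dA] := H z Az a fa.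
by apply/nbhs_polydiscP; exists d => // w zw Aw; exact: dA.
Qed.

Lemma usc1P (A : set (Cplx R)) (f : Cplx R -> \bar R) :
  upper_semicontinuous_on A f <-> forall z, A z -> forall a : R, (f z < a%:E)%E ->
    exists2 d : R, 0 < d & forall w, A w -> normc (w - z) < d -> (f w < a%:E)%E.
Proof.
split=> H z Az a fa.
  have /nbhs_normcP [d d0 dA] := H z Az a fa.
  by exists d => // w Aw zw; exact: (dA w zw Aw).
have [d d0 dA] := H z Az a fa.
by apply/nbhs_normcP; exists d => // w zw Aw; exact: dA.
Qed.

End Coordinates.

Lemma lte_real_between {R : realType} (x y : \bar R) :
  (x < y)%E -> exists2 c : R, (x < c%:E)%E & (c%:E < y)%E.
Proof.
case: x => [x| |] //; case: y => [y| |] //; rewrite ?lte_fin => xy.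
- by exists ((x + y) / 2); rewrite lte_fin; lra.
- by exists (x + 1); rewrite ?ltry// lte_fin; lra.
- by exists (y - 1); rewrite ?ltNyr// lte_fin; lra.
- by exists 0; rewrite ?ltNyr ?ltry.
Qed.

Lemma usc_comp {R : realType} {S T : topologicalType} (A : set T) (B : set S)
    (f : T -> \bar R) (phi : S -> T) :
  continuous phi -> (forall x, B x -> A (phi x)) -> upper_semicontinuous_on A f ->
  upper_semicontinuous_on B (f \o phi).
Proof.
move=> cphi Aphi uf x Bx a fa.
change (nbhs x [set y | B y -> (f (phi y) < a%:E)%E]).
have H : nbhs x [set y | A (phi y) -> (f (phi y) < a%:E)%E].
  exact: (cphi x _ (uf _ (Aphi x Bx) a fa)).
by apply: filterS H => y fy By; apply/fy/Aphi.
Qed.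

Lemma uscD_continuous {R : realType} {T : topologicalType} (A : set T)
    (f : T -> \bar R) (g : T -> R) : upper_semicontinuous_on A f ->
  continuous g -> upper_semicontinuous_on A (fun x => f x + (g x)%:E)%E.
Proof.
move=> uf cg x Ax a.
rewrite -lteBrDr// -EFinB => /lte_real_between [b fb].
rewrite lte_fin => bag.
have nf : nbhs x [set w | A w -> (f w < b%:E)%E] := uf x Ax b fb.
have ng : nbhs x [set w | g w < a - b].
  have gab : g x < a - b by lra.
  exact: (cg x _ (lt_nbhsl gab)).
change (nbhs x [set w | A w -> (f w + (g w)%:E < a%:E)%E]).
apply: filterS2 nf ng => w fw /= gw Aw.
by rewrite -lteBrDr// -EFinB; apply: (lt_trans (fw Aw)); rewrite lte_fin; lra.
Qed.

(** The sets {f > c} with c below the supremum generate a filter on [K], and semicontinuity forces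
    [f] to reach the supremum at any cluster point of it. A supremum equal to -oo means that [f] is
    constant. *)
Lemma usc_attains_max {R : realType} {T : topologicalType} (K : set T)
    (f : T -> \bar R) :
  compact K -> K !=set0 -> upper_semicontinuous_on K f ->
  exists2 x, K x & forall y, K y -> (f y <= f x)%E.
Proof.
move=> cK [k0 Kk0] uf; pose S := ereal_sup (f @` K).
have fS y : K y -> (f y <= S)%E by move=> Ky; apply: ereal_sup_ubound; exists y.
have [Sno|Sno] := eqVneq S -oo%E.
  by exists k0 => // y /fS; rewrite Sno leeNy_eq => /eqP ->; rewrite leNye.
pose G := filter_from [set c : \bar R | (c < S)%E] (fun c => [set y | K y /\ (c < f y)%E]).
have PG : ProperFilter G.
  apply: filter_from_proper; last first.
    move=> c /= cS; have [_ [y Ky <-] cy] := ereal_sup_gt cS; by exists y.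
  apply: filter_from_filter; first by exists -oo%E; rewrite /= ltNye.
  move=> c d /= cS dS; exists (maxe c d); first by rewrite gt_max cS.
  by move=> y [Ky]; rewrite gt_max => /andP[].
have [|x [Kx xG]] := cK G PG.
  by exists -oo%E; rewrite /= ?ltNye// => y [].
exists x => // y Ky; apply: (le_trans (fS y Ky)); rewrite leNgt; apply/negP => fxS.
have [c fxc cS] := lte_real_between fxS.
have Gc : G [set y | K y /\ (c%:E < f y)%E] by exists c%:E.
have [w [[Kw cw] /(_ Kw)]] := xG _ _ Gc (uf x Kx c fxc).
by move=> /(lt_trans cw); rewrite ltxx.
Qed.

(** * Averages over the circle *)

Section CircleAverage.
Context {R : realType}.
Implicit Types f g : R -> \bar R.
Local Notation mu := (@lebesgue_measure R).
Local Notation I := (`[0%R, (2 * pi)%R]%classic : set R).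

Definition avg f : \bar R := ((2 * pi)^-1)%:E * \int[mu]_(t in I) f t.

Let twopi_gt0 : 0 < 2 * pi :> R.
Proof. by rewrite mulr_gt0 ?pi_gt0. Qed.

Let twopiV_ge0 : (0 <= ((2 * pi)^-1 : R)%:E)%E.
Proof. by rewrite lee_fin invr_ge0 ltW. Qed.

Let mI : measurable I. Proof. exact: measurable_itv. Qed.

Let mu_I : mu I = (2 * pi)%:E.
Proof. by rewrite /= lebesgue_measure_itv /= lte_fin twopi_gt0 oppr0 adde0. Qed.

(** The integral of a nonnegative function is the supremum over the simple functions below it, which
    is monotone by inclusion. Means can thus be compared before the measurability of an integrand,
    such as an envelope, is known. *)
Lemma ge0_le_integral_unmeasurable (D : set R) f g :
  (forall x, D x -> (0 <= f x)%E) -> (forall x, D x -> (f x <= g x)%E) ->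
  (\int[mu]_(x in D) f x <= \int[mu]_(x in D) g x)%E.
Proof.
move=> f0 fg; have g0 x : D x -> (0 <= g x)%E by move=> Dx; exact: le_trans (f0 x Dx) (fg x Dx).
rewrite !ge0_integralE//; apply: ereal_sup_le => _ [h hf <-]; exists h => // x.
apply: (le_trans (hf x)); rewrite /patch; case: ifP => // /set_mem; exact: fg.
Qed.

Lemma le_avg f g : (forall t, 0 <= t <= 2 * pi -> (f t <= g t)%E) -> (avg f <= avg g)%E.
Proof.
move=> fg; rewrite /avg lee_wpmul2l//.
have fgI t : I t -> (f t <= g t)%E by rewrite /= in_itv /=; exact: fg.
rewrite integralE [leRHS]integralE leeB//; apply: ge0_le_integral_unmeasurable => //.
- by move=> t It; rewrite !funeposE ge_max le_max fgI//= le_max lexx orbT.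
- by move=> t It; rewrite !funenegE ge_max le_max leeN2 fgI//= le_max lexx orbT.
Qed.

Lemma avg_cst (c : R) : avg (fun=> c%:E) = c%:E.
Proof.
rewrite /avg integral_cst//= mu_I -!EFinM; congr EFin.
have := pi_gt0 R; move: (pi : R) => p p0; field; by rewrite ?lt0r_neq0.
Qed.

Lemma avg_EFin (f : R -> R) (F : R -> R) : continuous f ->
  (forall t : R, is_derive t (1 : R) F (f t)) ->
  avg (EFin \o f) = ((2 * pi)^-1 * (F (2 * pi) - F 0))%:E.
Proof.
move=> cf dF; have cF : continuous F.
  move=> t; apply/differentiable_continuous/derivable1_diffP; exact: (@ex_derive _ _ _ _ _ _ _ (dF t)).
rewrite /avg (@continuous_FTC2 _ f F)//.
- exact/continuous_subspaceT.
- split.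
  + by move=> t _; exact: (@ex_derive _ _ _ _ _ _ _ (dF t)).
  + by apply: cvg_at_right_filter; exact: cF.
  + by apply: cvg_at_left_filter; exact: cF.
- by move=> t _; rewrite derive1E; exact: (@derive_val _ _ _ _ _ _ _ (dF t)).
Qed.

(** Proved from an explicit primitive. The integrand covers every comparison function used later:
    squared real parts along circles and quadratic polynomials in cos t. *)
Lemma avg_trig (a e x A B : R) :
  avg (fun t => (a + e * (x + A * cos t + B * sin t) ^+ 2)%:E) =
  (a + e * (x ^+ 2 + (A ^+ 2 + B ^+ 2) / 2))%:E.
Proof.
pose F : R -> R := a *: (id : R -> R) + e *: (x ^+ 2 *: (id : R -> R)
  + (A ^+ 2 / 2) *: ((id : R -> R) + sin * cos)
  + (B ^+ 2 / 2) *: ((id : R -> R) - sin * cos)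
  + (2 * x * A) *: (sin : R -> R) - (2 * x * B) *: (cos : R -> R)
  + (A * B) *: (sin * sin : R -> R)).
pose f (t : R) := a + e * (x + A * cos t + B * sin t) ^+ 2.
change (avg (EFin \o f) = (a + e * (x ^+ 2 + (A ^+ 2 + B ^+ 2) / 2))%:E).
have FE t : F t = a * t + e * (x ^+ 2 * t + A ^+ 2 / 2 * (t + sin t * cos t)
  + B ^+ 2 / 2 * (t - sin t * cos t) + 2 * x * A * sin t - 2 * x * B * cos t
  + A * B * (sin t * sin t)) by [].
have dF t : is_derive t (1 : R) F (f t).
  have ds := is_derive_sin t; have dc := is_derive_cos t.
  have di := is_derive_id t (1 : R).
  have dsc := is_deriveM ds dc; have dss := is_deriveM ds ds.
  have D := is_deriveD (is_deriveZ a di) (is_deriveZ e (is_deriveD (is_deriveB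
    (is_deriveD (is_deriveD (is_deriveD (is_deriveZ (x ^+ 2) di)
      (is_deriveZ (A ^+ 2 / 2) (is_deriveD di dsc)))
      (is_deriveZ (B ^+ 2 / 2) (is_deriveB di dsc))) (is_deriveZ (2 * x * A) ds))
      (is_deriveZ (2 * x * B) dc)) (is_deriveZ (A * B) dss))).
  apply: (is_derive_eq D).
  rewrite /f /GRing.scale /=.
  have cs := cos2Dsin2 t; apply/subr0_eq.
  transitivity (e * (A ^+ 2 + B ^+ 2) / 2 * (1 - (cos t ^+ 2 + sin t ^+ 2))).
    move: (cos t) (sin t) => c s; by field.
  by rewrite cs subrr mulr0.
have cf : continuous f.
  have cxAB : continuous (fun t => x + A * cos t + B * sin t).
    move=> t; apply: cvgD; [apply: cvgD; [exact: cvg_cst|]|];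
      apply: cvgM; try exact: cvg_cst; [exact: continuous_cos|exact: continuous_sin].
  move=> t; apply: cvgD; first exact: cvg_cst.
  apply: cvgM; first exact: cvg_cst.
  rewrite expr2; under eq_fun do rewrite expr2.
  by apply: cvgM; exact: cxAB.
move: f cf F dF FE => f cf F dF FE.
rewrite (avg_EFin cf dF) !FE.
have s2 : sin (2 * pi) = 0 :> R by rewrite mulr_natl sin2pi.
have c2 : cos (2 * pi) = 1 :> R by rewrite mulr_natl cos2pi.
rewrite s2 c2 sin0 cos0; congr EFin.
have := pi_gt0 R; move: (pi : R) => p p0.
field; by rewrite ?lt0r_neq0.
Qed.

Let II t : I t <-> 0 <= t <= 2 * pi.
Proof. by rewrite /= in_itv. Qed.

Let EFin_subKe (M : R) (x : \bar R) : (M%:E - (M%:E - x))%E = x.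
Proof. by case: x => [r| |] //; rewrite -!EFinB; congr EFin; ring. Qed.

Let EFin_sube_ge0 (M : R) (x : \bar R) : (0 <= M%:E - x)%E = (x <= M%:E)%E.
Proof.
by case: x => [r| |] //=; rewrite ?leey ?leNye// -EFinB !lee_fin subr_ge0.
Qed.

Lemma usc_measurable f :
  upper_semicontinuous_on setT f -> measurable_fun setT f.
Proof.
move=> uf; rewrite (_ : f = (fun t => - (- f t))%E); last by apply/funext => t; rewrite oppeK.
apply: measurableT_comp => //.
apply: lower_semicontinuous_measurable => t a; rewrite lteNr -EFinN => fa.
have [V nV Vf] : exists2 V, nbhs t V & forall s, V s -> (f s < (- a)%:E)%E.
  exists [set s | setT s -> (f s < (- a)%:E)%E]; last by move=> s; exact.
  exact: (uf t Logic.I (- a)).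
by exists V => // s /Vf; rewrite lteNr EFinN.
Qed.

(** For integrable [f] this is linearity. Otherwise, [f] being bounded above, its integral is -oo
    and both sides are +oo. The identity carries results on nonnegative integrands over to functions
    that may be -oo. *)
Lemma avg_affine f (M : R) : measurable_fun I f ->
  (forall t, 0 <= t <= 2 * pi -> (f t <= M%:E)%E) ->
  avg (fun t => M%:E - f t)%E = (M%:E - avg f)%E.
Proof.
move=> mfI fM.
have fMI t : I t -> (f t <= M%:E)%E by move=> /II; exact: fM.
have icM : mu.-integrable I (fun=> M%:E).
  apply: continuous_compact_integrable; first exact: segment_compact.
  by apply: continuous_subspaceT => t; exact: cvg_cst.
have [fi|nfi] := pselect (mu.-integrable I f).
  rewrite /avg integralB// integral_cst//= mu_I muleBr; [|by []|by rewrite -EFinM fin_num_adde_defr].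
  congr (_ - _)%E; rewrite -!EFinM; congr EFin.
  by rewrite mulrCA mulVf ?mulr1// lt0r_neq0.
have mMf : measurable_fun I (fun t => M%:E - f t)%E.
  by apply: emeasurable_funB => //; exact: measurable_cst.
have intMf : (\int[mu]_(t in I) (M%:E - f t) = +oo)%E.
  have [//|ltoo] := eqVneq (\int[mu]_(t in I) (M%:E - f t))%E +oo%E.
  exfalso; apply: nfi.
  have iMf : mu.-integrable I (fun t => M%:E - f t)%E.
    apply/integrableP; split=> //.
    suff -> : (\int[mu]_(t in I) `|M%:E - f t| = \int[mu]_(t in I) (M%:E - f t))%E.
      by rewrite ltey.
    by apply: eq_integral => t /set_mem It; rewrite gee0_abs// EFin_sube_ge0// fMI.
  rewrite (_ : f = (cst M%:E \- (fun t => M%:E - f t))%E); first exact: integrableB.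
  apply/funext => t /=; case: (f t) => [r| |] //=; rewrite -EFinB; congr EFin; ring.
have intf : (\int[mu]_(t in I) f t = -oo)%E.
  have fpos : (\int[mu]_(t in I) (f^\+ t) < +oo)%E.
    apply: (@le_lt_trans _ _ (\int[mu]_(t in I) (maxe M%:E 0))%E).
      apply: ge0_le_integral_unmeasurable => t It.
        by rewrite funeposE le_max lexx orbT.
      by rewrite funeposE ge_max !le_max fMI//= lexx orbT.
    by rewrite integral_cst//= mu_I -EFin_max -EFinM ltry.
  (* Since [M - f] is at most [|M|] plus the negative part of [f], the infinite integral can only
     come from that negative part. *)
  have fneg : (\int[mu]_(t in I) (f^\- t) = +oo)%E.
    have : (+oo <= \int[mu]_(t in I) (`|M|%:E + f^\- t))%E.
      rewrite -intMf; apply: ge0_le_integral_unmeasurable => t It.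
        by rewrite EFin_sube_ge0// fMI.
      apply: leeD; first by rewrite lee_fin ler_norm.
      by rewrite funenegE le_max lexx.
    rewrite ge0_integralD//; last exact: measurable_funeneg.
    rewrite integral_cst//= mu_I -EFinM.
    by case: (\int[mu]_(t in I) _)%E.
  rewrite integralE fneg; case: (\int[mu]_(t in I) (f^\+ t))%E fpos => //.
rewrite /avg intMf intf gt0_muley ?lte_fin ?invr_gt0// gt0_muleNy ?lte_fin ?invr_gt0//.
Qed.

(** The reflection in the opposite direction: [M - f] is bounded above by [M], and [avg_affine]
    applied to it returns [f], which may be +oo. *)
Lemma avg_affine_ge0 f (M : R) : measurable_fun I f ->
  (forall t, (0 <= f t)%E) ->
  avg (fun t => M%:E - f t)%E = (M%:E - avg f)%E.
Proof.
move=> mf f0; rewrite -[LHS](EFin_subKe M) -avg_affine.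
- by under eq_fun do rewrite EFin_subKe.
- by apply: emeasurable_funB => //; exact: measurable_cst.
- move=> t _; have := f0 t; case: (f t) => [r| |] //=; last by rewrite leNye.
  by rewrite -EFinB !lee_fin; lra.
Qed.

Lemma avgB_cst f (M c : R) : measurable_fun I f -> (forall t, (f t <= M%:E)%E) ->
  avg (fun t => f t - c%:E)%E = (avg f - c%:E)%E.
Proof.
move=> mf fM; pose g t := ((M + c)%:E - (f t + c%:E))%E.
have gE t : g t = (M%:E - f t)%E.
  by rewrite /g; case: (f t) => [r| |] //=; rewrite -EFinB; congr EFin; ring.
have g0 t : (0 <= g t)%E by rewrite gE EFin_sube_ge0.
have mg : measurable_fun I g.
  rewrite (_ : g = (fun t => M%:E - f t)%E); last by apply/funext.
  by apply: emeasurable_funB => //; exact: measurable_cst.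
rewrite (_ : (fun t => f t - c%:E)%E = (fun t => (M - c)%:E - g t)%E); last first.
  apply/funext => t; rewrite gE; case: (f t) => [r| |] //=.
  by rewrite -!EFinB; congr EFin; ring.
rewrite avg_affine_ge0// (_ : g = (fun t => M%:E - f t)%E); last by apply/funext.
rewrite avg_affine//; case: (avg f) => [r| |] //=; rewrite -!EFinB; congr EFin; ring.
Qed.

(** Reverse Fatou: Fatou's lemma for [M - F k]. The pointwise hypothesis is limsup F k t <= f t
    written with real thresholds, the form in which upper semicontinuity along a convergent sequence
    provides it. *)
Lemma avg_limsup_ge (F : nat -> R -> \bar R) f (M c : R) :
  (forall k, measurable_fun setT (F k)) -> measurable_fun setT f ->
  (forall k t, 0 <= t <= 2 * pi -> (F k t <= M%:E)%E) ->
  (forall t, 0 <= t <= 2 * pi -> (f t <= M%:E)%E) ->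
  (forall t (a : R), 0 <= t <= 2 * pi -> (f t < a%:E)%E ->
    \forall k \near \oo, (F k t < a%:E)%E) ->
  (forall k, (c%:E <= avg (F k))%E) ->
  (c%:E <= avg f)%E.
Proof.
move=> mF mf FM fM Ff cF.
have mFI k : measurable_fun I (F k) by exact: measurable_funTS.
have mfI : measurable_fun I f by exact: measurable_funTS.
pose G k t := (M%:E - F k t)%E.
have mG k : measurable_fun I (G k).
  by apply: emeasurable_funB => //; exact: measurable_cst.
have G0 k t : I t -> (0 <= G k t)%E by move=> /II It; rewrite EFin_sube_ge0// FM.
have fatouG := fatou mu mI mG G0.
have liminfE (u : nat -> \bar R) : limn_einf u = ereal_sup (range (einfs u)).
  by rewrite limn_einf_lim; apply/cvg_lim => //; exact: cvg_einfs_sup.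
have fG t : 0 <= t <= 2 * pi -> (M%:E - f t <= limn_einf (G^~ t))%E.
  move=> It; rewrite leNgt; apply/negP => /lte_real_between [b].
  rewrite ltNge => /negP + bf; apply.
  have : (f t < (M - b)%:E)%E.
    move: bf; case: (f t) => [r| |] //=; rewrite ?ltNyr// -?EFinB ?lte_fin; lra.
  move=> /(Ff t _ It) [N _ HN].
  rewrite liminfE; apply: le_ereal_sup_tmp; exists (einfs (G^~ t) N); first by exists N.
  apply: le_ereal_inf_tmp => _ [k /= Nk <-].
  have := HN k Nk; rewrite /= /G; case: (F k t) => [r| |] //=.
    by rewrite -EFinB lte_fin lee_fin; lra.
  by rewrite leey.
have liminf_le : (limn_einf (fun k => \int[mu]_(t in I) G k t) <= (2 * pi * (M - c))%:E)%E.
  rewrite liminfE; apply: ge_ereal_sup => _ [N _ <-].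
  apply: (@le_trans _ _ (\int[mu]_(t in I) G N t)%E).
    by apply: ereal_inf_lbound; exists N => /=.
  have := cF N; have := avg_affine (mFI N) (FM N); rewrite -/(G N) {1}/avg => GE cFN.
  have : (((2 * pi)^-1)%:E * \int[mu]_(t in I) G N t <= (M - c)%:E)%E.
    by rewrite GE EFinB leeB.
  by rewrite -lee_pdivlMl// ?invr_gt0// invrK EFinM.
have : (avg (fun t => M%:E - f t) <= (M - c)%:E)%E.
  apply: (@le_trans _ _ (avg (fun t => limn_einf (G^~ t)))); first exact: le_avg.
  rewrite /avg -lee_pdivlMl// ?invr_gt0// invrK -EFinM.
  exact: le_trans fatouG liminf_le.
rewrite avg_affine//; case: (avg f) => [r| |] //=; rewrite ?leey//.
by rewrite -EFinB !lee_fin; lra.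
Qed.

(** The image of Lebesgue measure under a translation agrees with it on half-open intervals, hence
    everywhere; what remains is the change of variables for an image measure. *)
Lemma integral_shift (D : set R) f (s : R) : measurable D -> measurable_fun D f ->
  (forall t, D t -> (0 <= f t)%E) ->
  (\int[mu]_(t in [set t | D (t + s)%R]) f (t + s)%R = \int[mu]_(t in D) f t)%E.
Proof.
move=> mD mf f0.
pose sh : measurableTypeR R -> measurableTypeR R := fun t => t + s.
have ms : measurable_fun setT sh.
  by apply: measurable_funD => //; exact: measurable_cst.
transitivity (\int[pushforward mu sh]_(t in D) f t)%E.
  by rewrite ge0_integral_pushforward// => t /set_mem; exact: f0.
apply: eq_measure_integral => A mA _; apply/esym.
apply: lebesgue_measure_unique => // _ [[a b]] _ <-.
have E : sh @^-1` `]a, b]%classic = `]a - s, b - s]%classic.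
  by apply/seteqP; split => t /=; rewrite /sh !in_itv /=; lra.
rewrite [RHS](_ : _ = mu (sh @^-1` `]a, b]%classic))// E.
rewrite !lebesgue_measure_itv /= !lte_fin ltrD2r.
by case: ifP => // _; rewrite -!EFinD; congr EFin; lra.
Qed.

Lemma ge0_integral_itv_cat f (a b c : R) : measurable_fun setT f ->
  (forall t, (0 <= f t)%E) -> a <= b <= c ->
  (\int[mu]_(t in `[a, c[) f t =
   \int[mu]_(t in `[a, b[) f t + \int[mu]_(t in `[b, c[) f t)%E.
Proof.
move=> mf f0 /andP[ab bc]; rewrite -ge0_integral_setU//.
- by rewrite -itv_bndbnd_setU// bnd_simp.
- exact: measurable_funTS.
- apply/disj_setPS => t [] /=; rewrite !in_itv /=; lra.
Qed.

Lemma avg_shift f (s M : R) : measurable_fun setT f ->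
  (forall t, f (t + 2 * pi) = f t) ->
  (forall t, (f t <= M%:E)%E) -> 0 <= s <= 2 * pi ->
  avg (fun t => f (t + s)) = avg f.
Proof.
move=> mf pf fM s02.
pose g t := (M%:E - f t)%E.
have g0 t : (0 <= g t)%E by rewrite EFin_sube_ge0.
have mg : measurable_fun setT g by apply: emeasurable_funB => //; exact: measurable_cst.
pose sh : measurableTypeR R -> measurableTypeR R := fun t => t + s.
have msh : measurable_fun setT sh.
  by apply: measurable_funD => //; exact: measurable_cst.
have ms : measurable_fun setT (f \o sh) by exact: measurableT_comp.
have mgs : measurable_fun setT (g \o sh) by exact: measurableT_comp.
have pg t : g (t + 2 * pi) = g t by rewrite /g pf.
suff E : avg (fun t => g (t + s)) = avg g.
  have := E; rewrite /g !avg_affine//; try exact: measurable_funTS.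
  case: (avg (fun t => f (t + s))) => [x| |]; case: (avg f) => [y| |] //=.
  by rewrite -!EFinB => -[] /addrI /oppr_inj ->.
rewrite /avg; congr (_ * _)%E.
(* Half-open intervals can be cut and reassembled: [s, 2 pi + s[ is split at 2 pi, and its last
   piece goes back by one period onto [0, s[. *)
rewrite -!integral_itv_bndo_bndc; [|exact: measurable_funTS..].
have shiftE (a b d : R) : (\int[mu]_(t in `[a, b[) g (t + d)%R =
    \int[mu]_(t in `[(a + d)%R, (b + d)%R[) g t)%E.
  rewrite -(@integral_shift _ g d)//; last exact: measurable_funTS.
  congr (integral _ _ _); apply/seteqP; split => t /=; rewrite !in_itv /=; lra.
have [s0 s2] := andP s02.
rewrite shiftE add0r (@ge0_integral_itv_cat g s (2 * pi) (2 * pi + s))//; last by lra.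
rewrite [RHS](@ge0_integral_itv_cat g 0 s (2 * pi))// [RHS]addeC; congr (_ + _)%E.
rewrite -[in LHS](add0r (2 * pi)) [X in `[_, X[](_ : _ = s + 2 * pi); last by lra.
by rewrite -shiftE; apply: eq_integral => t _; rewrite pg.
Qed.

(** Every point of an open set lies in a rational box inside it, so the set is a countable union of
    boxes. This makes a semicontinuous function of two angles measurable for the product
    sigma-algebra. *)
Lemma open_measurable_prod (A : set (R * R)) : open A ->
  measurable (A : set (measurableTypeR R * measurableTypeR R)).
Proof.
move=> oA.
pose box (a b c d : rat) : set (R * R) := `](ratr a), (ratr b)[ `*` `](ratr c), (ratr d)[.
pose B (a b c d : rat) := [set p | box a b c d `<=` A /\ box a b c d p].
rewrite (_ : A = \bigcup_a \bigcup_b \bigcup_c \bigcup_d B a b c d).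
  apply: bigcupT_measurable_rat => a; apply: bigcupT_measurable_rat => b.
  apply: bigcupT_measurable_rat => c; apply: bigcupT_measurable_rat => d.
  have [sA|nsA] := pselect (box a b c d `<=` A).
    rewrite (_ : B a b c d = box a b c d); first by apply: measurableX; exact: measurable_itv.
    by apply/seteqP; split => p //= [].
  rewrite (_ : B a b c d = set0); first exact: measurable0.
  by apply/seteqP; split => p //= [].
apply/seteqP; split => [[x y] Axy|p [a _ [b _ [c _ [d _ [sA]]]]]]; last exact: sA.
have : nbhs (x, y) A by exact: open_nbhs_nbhs.
case=> -[U V] /= [/nbhs_ballP [e /= e0 eU] /nbhs_ballP [d /= d0 dV]] UV.
have around (z r : R) : 0 < r -> exists a b : rat, [/\ z - r < ratr a, ratr a < z,
    z < ratr b & ratr b < z + r].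
  move=> r0; have zr : z - r < z by lra.
  have zr' : z < z + r by lra.
  have [a] := rat_in_itvoo zr; rewrite in_itv /= => /andP[a1 a2].
  have [b] := rat_in_itvoo zr'; rewrite in_itv /= => /andP[b1 b2].
  by exists a, b.
have [a [b [a1 a2 b1 b2]]] := around x e e0.
have [a' [b' [a1' a2' b1' b2']]] := around y d d0.
exists a => //; exists b => //; exists a' => //; exists b' => //; split.
  move=> [p q] [] /=; rewrite !in_itv /= => /andP[p1 p2] /andP[q1 q2].
  apply: UV; split => /=.
    by apply: eU; rewrite /ball /= ltr_norml; lra.
  by apply: dV; rewrite /ball /= ltr_norml; lra.
by split; rewrite /= ?in_itv /=; lra.
Qed.

(** Tonelli for the nonnegative function [M - f], extended by zero outside the square of [I] so that
    the theorem on the whole plane gives iterated integrals over one period. *)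
Lemma avg_exchange (f : R -> R -> \bar R) (M : R) :
  (forall s t, (f s t <= M%:E)%E) ->
  upper_semicontinuous_on setT (fun p : R * R => f p.1 p.2) ->
  avg (fun s => avg (f s)) = avg (fun t => avg (f ^~ t)).
Proof.
move=> fM uf.
pose T2 := (measurableTypeR R * measurableTypeR R)%type.
pose G : T2 -> \bar R := fun p => (M%:E - f p.1 p.2)%E.
have G0 p : (0 <= G p)%E by rewrite EFin_sube_ge0.
have mG : measurable_fun setT G.
  apply: (measurability _ (ErealGenOInfty.measurableE R)).
  move=> /= _ [_ [a ->]] <-; apply: measurableI => //; apply: open_measurable_prod.
  rewrite openE => p; rewrite /= in_itv /= andbT => aG.
  have fp : (f p.1 p.2 < (M - a)%:E)%E.
    move: aG; rewrite /G; case: (f p.1 p.2) => [r| |] //=; rewrite ?ltNyr// -?EFinB ?lte_fin; lra.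
  have : nbhs p [set q | setT q -> (f q.1 q.2 < (M - a)%:E)%E] by exact: (uf p Logic.I).
  apply: filterS => q /(_ Logic.I) fq; rewrite /= in_itv /= andbT.
  move: fq; rewrite /G; case: (f q.1 q.2) => [r| |] //=; last by rewrite ltry.
  by rewrite -EFinB !lte_fin; lra.
pose H : T2 -> \bar R := G \_ (I `*` I).
have mII : measurable (I `*` I : set T2) by exact: measurableX.
have mH : measurable_fun setT H by apply/(measurable_restrictT _ mII); exact: measurable_funTS.
have H0 p : (0 <= H p)%E by rewrite /H patchE; case: ifP.
have HI s t : I s -> I t -> H (s, t) = G (s, t).
  by move=> Is It; rewrite /H patchE ifT//; apply/mem_set.
have HnI s t : ~ (I s /\ I t) -> H (s, t) = 0%E.
  by move=> nI; rewrite /H patchE ifF//; apply/negbTE/negP => /set_mem.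
have F1 s : I s -> (\int[mu]_t H (s, t) = \int[mu]_(t in I) (M%:E - f s t))%E.
  move=> Is; rewrite [RHS]integral_mkcond; apply: eq_integral => t _; rewrite patchE.
  by case: ifPn => [/set_mem It|/negP nIt]; [exact: HI|apply: HnI => -[_ It]; apply: nIt; exact/mem_set].
have F2 t : I t -> (\int[mu]_s H (s, t) = \int[mu]_(s in I) (M%:E - f s t))%E.
  move=> It; rewrite [RHS]integral_mkcond; apply: eq_integral => s _; rewrite patchE.
  by case: ifPn => [/set_mem Is|/negP nIs]; [exact: HI|apply: HnI => -[Is _]; apply: nIs; exact/mem_set].
have G1 : (\int[mu]_s \int[mu]_t H (s, t) = \int[mu]_(s in I) \int[mu]_(t in I) (M%:E - f s t))%E.
  rewrite [RHS]integral_mkcond; apply: eq_integral => s _; rewrite patchE.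
  case: ifPn => [/set_mem Is|/negP nIs]; first exact: F1.
  by apply: integral0_eq => t _; apply: HnI => -[Is _]; apply: nIs; exact/mem_set.
have G2 : (\int[mu]_t \int[mu]_s H (s, t) = \int[mu]_(t in I) \int[mu]_(s in I) (M%:E - f s t))%E.
  rewrite [RHS]integral_mkcond; apply: eq_integral => t _; rewrite patchE.
  case: ifPn => [/set_mem It|/negP nIt]; first exact: F2.
  by apply: integral0_eq => s _; apply: HnI => -[_ It]; apply: nIt; exact/mem_set.
have EG := fubini_tonelli (m1 := mu) (m2 := mu) H mH H0.
have m1 : measurable_fun I (fun s => \int[mu]_(t in I) (M%:E - f s t))%E.
  apply: (eq_measurable_fun (fun s => \int[mu]_t H (s, t))%E).
    by move=> s /set_mem; exact: F1.
  by apply: measurable_funTS; exact: (measurable_fun_fubini_tonelli_F (m2 := mu) H).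
have m2 : measurable_fun I (fun t => \int[mu]_(s in I) (M%:E - f s t))%E.
  apply: (eq_measurable_fun (fun t => \int[mu]_s H (s, t))%E).
    by move=> t /set_mem; exact: F2.
  by apply: measurable_funTS; exact: (measurable_fun_fubini_tonelli_G (m1 := mu) H).
have mfs s : measurable_fun I (f s).
  rewrite (_ : f s = (fun t => M%:E - G (s, t))%E); last first.
    by apply/funext => t; rewrite EFin_subKe.
  apply: measurable_funTS; apply: emeasurable_funB; first exact: measurable_cst.
  exact: (measurableT_comp mG (pair1_measurable s)).
have mft t : measurable_fun I (f^~ t).
  rewrite (_ : f^~ t = (fun s => M%:E - G (s, t))%E); last first.
    by apply/funext => s; rewrite EFin_subKe.
  apply: measurable_funTS; apply: emeasurable_funB; first exact: measurable_cst.
  exact: (measurableT_comp mG (pair2_measurable t)).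
have E1 s : avg (f s) = (M%:E - avg (fun t => M%:E - f s t))%E.
  by rewrite (avg_affine (mfs s) (fun t _ => fM s t)) EFin_subKe.
have E2 t : avg (f^~ t) = (M%:E - avg (fun s => M%:E - f s t))%E.
  by rewrite (avg_affine (mft t) (fun s _ => fM s t)) EFin_subKe.
have c0 : 0 <= (2 * pi : R)^-1 by rewrite invr_ge0 ltW.
have int0 (g : R -> \bar R) : (forall t, (0 <= g t)%E) -> (0 <= \int[mu]_(t in I) g t)%E.
  by move=> g0; apply: integral_ge0.
have I1 s : (0 <= \int[mu]_(t in I) (M%:E - f s t))%E by apply: int0 => t; exact: (G0 (s, t)).
have I2 t : (0 <= \int[mu]_(s in I) (M%:E - f s t))%E by apply: int0 => s; exact: (G0 (s, t)).
under eq_fun do rewrite E1; under [in RHS]eq_fun do rewrite E2.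
have A0 g : (0 <= \int[mu]_(t in I) g t)%E -> (0 <= avg g)%E.
  by move=> g0; rewrite /avg mule_ge0.
rewrite !avg_affine_ge0; [|exact: measurable_funeM|by move=> t; exact: A0
  |exact: measurable_funeM|by move=> t; exact: A0].
have avgZ (k : R) (g : R -> \bar R) : measurable_fun I g ->
    (forall t, (0 <= g t)%E) -> 0 <= k ->
    avg (fun t => k%:E * g t)%E = (k%:E * avg g)%E.
  by move=> mg g0 k0; rewrite /avg ge0_integralZl_EFin// muleCA.
have A1 := avgZ _ _ m1 I1 c0; have A2 := avgZ _ _ m2 I2 c0.
rewrite [X in (_ - X)%E]A1 [X in _ = (_ - X)%E]A2 /avg -G1 -G2 EG//.
Qed.

Lemma avg_continuousD (f g : R -> R) (c : R) : continuous f -> continuous g ->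
  avg (fun t => (f t + c * g t)%:E) = (avg (EFin \o f) + c%:E * avg (EFin \o g))%E.
Proof.
move=> cf cg.
have int (h : R -> R) : continuous h -> mu.-integrable I (EFin \o h).
  move=> ch; apply: continuous_compact_integrable; first exact: segment_compact.
  exact: continuous_subspaceT.
rewrite /avg; under eq_integral do rewrite EFinD EFinM.
rewrite integralD//; [|exact: int|]; last by apply: integrableZl => //; exact: int.
rewrite integralZl//; last exact: int.
have /integrable_fin_num fi := int _ cf; have /integrable_fin_num gi := int _ cg.
rewrite muleDr//; last by rewrite fin_num_adde_defr// fi.
by rewrite muleCA.
Qed.

End CircleAverage.

(** * From small discs to all discs *)

Section LocalSubmean.
Context {R : realType}.

Definition expi (t : R) : Cplx R := (cos t +i* sin t)%C.

Lemma expiD (s t : R) : expi (s + t) = expi s * expi t.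
Proof.
apply/eqP; rewrite eq_complex /= cosD sinD; apply/andP; split; apply/eqP; ring.
Qed.

Lemma normc_expi (t : R) : normc (expi t) = 1.
Proof. by rewrite /= cos2Dsin2 sqrtr1. Qed.

Lemma expi_periodic (t : R) : expi (t + 2 * pi) = expi t.
Proof. by rewrite /expi mulr_natl cosD2pi sinD2pi. Qed.

Lemma circle_pointE (a : Cplx R) (r t : R) :
  circle_point a r t = a + r%:C%C * expi t.
Proof.
rewrite /circle_point; congr (_ + _).
by apply/eqP; rewrite eq_complex /= !mul0r subr0 addr0 !eqxx.
Qed.

Lemma normc_circle_point (a : Cplx R) (r t : R) : 0 <= r ->
  normc (circle_point a r t - a) = r.
Proof.
move=> r0; rewrite circle_pointE addrC addKr ComplexField.Normc.normcM normc_expi mulr1.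
by rewrite normc_real ger0_norm.
Qed.

Lemma closed_disc_circle_point (a : Cplx R) (r t : R) : 0 <= r ->
  closed_disc a r (circle_point a r t).
Proof. by move=> r0; rewrite /closed_disc /= normc_circle_point. Qed.

Lemma Re_circle_point (a : Cplx R) (r t : R) :
  Re (circle_point a r t) = Re a + r * cos t.
Proof. by case: a. Qed.

Lemma polar_form (z : Cplx R) : exists2 t : R, 0 <= t <= 2 * pi &
  z = (normc z)%:C%C * expi t.
Proof.
have [->|z0] := eqVneq z 0.
  exists 0; first by rewrite lexx mulr_ge0 ?pi_ge0.
  by rewrite ComplexField.Normc.normc0 mul0r.
have nz0 : 0 < normc z.
  rewrite lt_neqAle normc_ge0 andbT eq_sym; apply: contraNneq z0 => /ComplexField.Normc.eq0_normc ->//.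
case: z z0 nz0 => x y _ /=; set r := Num.sqrt _ => r0.
have r2 : r ^+ 2 = x ^+ 2 + y ^+ 2 by rewrite sqr_sqrtr ?addr_ge0 ?sqr_ge0.
pose c := x / r; pose s := y / r.
have cs : c ^+ 2 + s ^+ 2 = 1.
  rewrite /c /s !expr_div_n -mulrDl -r2 divff// lt0r_neq0// exprn_gt0//.
have c1 : -1 <= c <= 1.
  by rewrite -ler_norml -sqrtr_sqr -[leRHS]sqrtr1 ler_sqrt// -cs lerDl sqr_ge0.
have sE : Num.sqrt (1 - c ^+ 2) = `|s| by rewrite -cs addrC addKr sqrtr_sqr.
have [a0 api] : 0 <= acos c /\ acos c <= pi by rewrite acos_ge0 ?acos_lepi.
have pi0 := pi_ge0 R.
have xE : x = r * c by rewrite /c mulrCA divff ?mulr1 ?lt0r_neq0.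
have yE : y = r * s by rewrite /s mulrCA divff ?mulr1 ?lt0r_neq0.
(* The arc cosine only reaches the upper half circle; points below the real axis get the angle 2 pi
   - acos c. *)
have [s0|s0] := leP 0 s.
  exists (acos c); first by lra.
  apply/eqP; rewrite eq_complex /= !mul0r subr0 addr0 acosK// sin_acos// sE ger0_norm//.
  by rewrite -xE -yE !eqxx.
exists (2 * pi - acos c); first by lra.
have -> : expi (2 * pi - acos c) = (c +i* s)%C.
  rewrite /expi addrC mulr_natl cosD2pi sinD2pi cosN sinN acosK// sin_acos// sE ltr0_norm//.
  by rewrite opprK.
by apply/eqP; rewrite eq_complex /= !mul0r subr0 addr0 -xE -yE !eqxx.
Qed.

Lemma continuous_expi : continuous expi.
Proof.
move=> t B /nbhs_normcP [e e0 eB].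
have e20 : 0 < e / 2 by rewrite divr_gt0.
have /cvgrPdist_lt /(_ _ e20) ct := @continuous_cos R t.
have /cvgrPdist_lt /(_ _ e20) st := @continuous_sin R t.
change (nbhs t [set s | B (expi s)]).
apply: filterS2 ct st => s /= cts sts; apply: eB.
rewrite (_ : expi s - expi t = (cos s - cos t)%:C%C + (0 +i* (sin s - sin t))%C); last first.
  by apply/eqP; rewrite eq_complex /= addr0 add0r !eqxx.
apply: (le_lt_trans (normcD_le _ _)); rewrite (splitr e) ltrD//.
  by rewrite normc_real distrC.
by rewrite /= expr0n /= add0r sqrtr_sqr distrC.
Qed.

Lemma continuous_circle_point (a : Cplx R) (r : R) : continuous (circle_point a r).
Proof.
rewrite (_ : circle_point a r = (fun t => a + r%:C%C * expi t)); last first.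
  by apply/funext => t; rewrite circle_pointE.
by apply: continuous_affine; [exact: cst_continuous|exact: continuous_expi].
Qed.

Lemma measurable_circle (U : set (Cplx R)) (f : Cplx R -> \bar R) (a : Cplx R) (r : R) :
  0 <= r -> closed_disc a r `<=` U -> upper_semicontinuous_on U f ->
  measurable_fun setT (fun t => f (circle_point a r t)).
Proof.
move=> r0 sU uf; apply: usc_measurable.
apply: (usc_comp (A := U) (phi := circle_point a r)) => //.
  exact: continuous_circle_point.
by move=> t _; apply: sU; exact: closed_disc_circle_point.
Qed.

Lemma usc_bounded {T : topologicalType} (K : set T) (f : T -> \bar R) :
  compact K -> upper_semicontinuous_on K f -> (forall x, K x -> (f x < +oo)%E) ->
  exists M : R, forall x, K x -> (f x <= M%:E)%E.
Proof.
move=> cK uf foo; have [[x Kx]|/set0P/negP/negPn/eqP ->] := pselect (K !=set0); last by exists 0.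
have [y Ky fy] := usc_attains_max cK (ex_intro _ x Kx) uf.
have := foo y Ky; case: (f y) fy => [M| |] // fy _; first by exists M.
by exists 0 => z /fy; rewrite leeNy_eq => /eqP ->; rewrite leNye.
Qed.

Lemma compact_closed_disc (a : Cplx R) (r : R) : compact (closed_disc a r).
Proof.
rewrite (_ : closed_disc a r = (fun z => a + z) @` [set z : Cplx R | normc z <= r]).
  apply: continuous_compact; last exact: compact_normc_le.
  apply: continuous_subspaceT => z; apply: continuousD; first exact: cst_continuous.
  exact: (@cvg_id _ _).
apply/seteqP; split => [z za|_ [z zr <-]].
  by exists (z - a) => //; rewrite addrC subrK.
by rewrite /closed_disc /= addrC addKr.
Qed.

(* Averaging f over all rotations about a yields a radial function satisfying
   the same local inequality; the maximum principle then compares its value at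
   the centre with its constant value on the boundary circle. *)
Lemma submean_of_local (f : Cplx R -> \bar R) (a : Cplx R) (r eta : R) :
  0 < r -> 0 < eta -> upper_semicontinuous_on (closed_disc a r) f ->
  (forall z, closed_disc a r z -> (f z < +oo)%E) ->
  (forall c rho, 0 < rho -> rho < eta -> normc (c - a) + rho <= r ->
     (f c <= avg (fun t => f (circle_point c rho t)))%E) ->
  (f a <= avg (fun t => f (circle_point a r t)))%E.
Proof.
move=> r0 eta0 uf foo sub.
have [M fM] := usc_bounded (@compact_closed_disc a r) uf foo.
pose D0 := [set l : Cplx R | normc l <= r].
pose A l := avg (fun t => f (a + expi t * l)).
have rotD l t : D0 l -> closed_disc a r (a + expi t * l).
  by move=> Dl; rewrite /closed_disc /= addrC addKr ComplexField.Normc.normcM normc_expi mul1r.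
have crot l : continuous (fun t => a + expi t * l).
  by apply: continuous_affine; [exact: continuous_expi|exact: cst_continuous].
have mrot l : D0 l -> measurable_fun setT (fun t => f (a + expi t * l)).
  move=> Dl; apply: usc_measurable.
  by apply: (usc_comp (A := closed_disc a r) (phi := fun t => a + expi t * l)) => // t _; exact: rotD.
have Acirc l : normc l = r -> A l = avg (fun t => f (circle_point a r t)).
  move=> lr; have [s s02 lE] := polar_form l.
  rewrite -(@avg_shift R (fun t => f (circle_point a r t)) s M)//.
  - rewrite /A; congr avg; apply/funext => t; congr f.
    by rewrite circle_pointE expiD lE lr; congr (_ + _); rewrite mulrCA mulrC; ring.
  - by apply: (measurable_circle (ltW r0) (@subset_refl _ _)) => //.
  - by move=> t; rewrite !circle_pointE expi_periodic.
  - by move=> t; apply: fM; apply: closed_disc_circle_point; exact: ltW.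
(* The local inequality holds on each rotated small circle. Rotating the centre by t also shifts the
   angle on the circle by t, which [avg_shift] absorbs; exchanging the two means then leaves the
   mean of [A] over the unrotated circle. *)
have Asub l rho : 0 < rho -> rho < eta -> normc l + rho <= r ->
    (A l <= avg (fun s => A (circle_point l rho s)))%E.
  move=> rho0 rhoe lrho.
  have Dcp s : D0 (circle_point l rho s).
    rewrite /D0 /=; apply: le_trans lrho.
    rewrite -[X in normc X](subrK l) addrC; apply: (le_trans (normcD_le _ _)).
    by rewrite lerD2l normc_circle_point// ltW.
  have Dl : D0 l by apply: le_trans lrho; rewrite lerDl ltW.
  apply: (@le_trans _ _ (avg (fun t => avg (fun s => f (a + expi t * circle_point l rho s))))).
    apply: le_avg => t t02.
    have := sub (a + expi t * l) rho rho0 rhoe.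
    rewrite (addrAC a) subrr add0r ComplexField.Normc.normcM normc_expi mul1r.
    move=> /(_ lrho) /le_trans; apply.
    rewrite (_ : (fun s => f (a + expi t * circle_point l rho s)) =
      (fun s => f (circle_point (a + expi t * l) rho (s + t)))); last first.
      apply/funext => s; congr f; rewrite !circle_pointE expiD; ring.
    have sD : closed_disc (a + expi t * l) rho `<=` closed_disc a r.
      move=> z; rewrite /closed_disc /= => zl; apply: le_trans lrho.
      rewrite (_ : z - a = expi t * l + (z - (a + expi t * l))); last by ring.
      apply: (le_trans (normcD_le _ _)).
      by rewrite ComplexField.Normc.normcM normc_expi mul1r lerD2l.
    rewrite (@avg_shift R (fun s => f (circle_point (a + expi t * l) rho s)) t M)//.
    - exact: (measurable_circle (ltW rho0) sD).
    - by move=> s; rewrite !circle_pointE expi_periodic.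
    - by move=> s; apply/fM/sD/closed_disc_circle_point; exact: ltW.
  rewrite (@avg_exchange R (fun t s => f (a + expi t * circle_point l rho s)) M)//.
    by move=> t s; apply: fM; apply: rotD; exact: Dcp.
  apply: (usc_comp (A := closed_disc a r)
    (phi := fun p : R * R => a + expi p.1 * circle_point l rho p.2)) => //.
    apply: continuous_affine => p.
      by apply: (@continuous_comp _ _ _ fst expi); [exact: cvg_fst|exact: continuous_expi].
    by apply: (@continuous_comp _ _ _ snd (circle_point l rho));
      [exact: cvg_snd|exact: continuous_circle_point].
  by move=> p _; apply: rotD; exact: Dcp.
(* If semicontinuity failed at l, points w k converging to l would have [A (w k) >= c > A l],
   against reverse Fatou along that sequence. *)
have Ausc : upper_semicontinuous_on D0 A.
  apply/usc1P => l Dl c Ac; apply: contrapT => nex.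
  have seq k : exists w, [/\ D0 w, normc (w - l) < k.+1%:R^-1 & (c%:E <= A w)%E].
    apply: contrapT => nw; apply: nex; exists k.+1%:R^-1; first by rewrite invr_gt0.
    move=> w Dw wl; rewrite ltNge; apply/negP => cA; apply: nw; by exists w.
  have [w Hw] := choice seq.
  suff : (c%:E <= A l)%E by rewrite leNgt Ac.
  apply: (@avg_limsup_ge R (fun k t => f (a + expi t * w k)) _ M).
  - by move=> k; apply: mrot; have [] := Hw k.
  - exact: mrot.
  - by move=> k t _; apply/fM/rotD; have [] := Hw k.
  - by move=> t _; exact/fM/rotD.
  - move=> t b _ fb; have /usc1P /(_ _ (rotD l t Dl) b fb) [d d0 Hd] := uf.
    near=> k; apply: Hd; first by apply: rotD; have [] := Hw k.
    rewrite (_ : _ - _ = expi t * (w k - l)); last by ring.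
    rewrite ComplexField.Normc.normcM normc_expi mul1r.
    have [_ wl _] := Hw k; apply: (lt_trans wl); near: k.
    exact: near_infty_natSinv_lt (PosNum d0).
  - by move=> k; have [] := Hw k.
have A0 : (f a <= A 0%R)%E.
  rewrite /A (_ : (fun t => f (a + expi t * 0)) = (fun=> f a)); last first.
    by apply/funext => t; rewrite mulr0 addr0.
  have : closed_disc a r a by rewrite /closed_disc /= subrr ComplexField.Normc.normc0 ltW.
  by move=> /foo; case: (f a) => [x| |] // _; [rewrite avg_cst|rewrite leNye].
rewrite leNgt; apply/negP => /lte_real_between [c Cc cf].
have faE : f a = (fine (f a))%:E.
  move: cf; have : closed_disc a r a by rewrite /closed_disc /= subrr ComplexField.Normc.normc0 ltW.
  by move=> /foo; case: (f a).
move: faE cf A0; set fa := fine (f a) => -> cf A0.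
(* Adding [eps * (Re l)^2] to [A] makes it strictly subharmonic. This [eps] keeps the added term at
   most fa - c on the disc, so a maximum on the boundary circle, where A < c, would be smaller than
   fa, although the value at the centre is at least fa. *)
pose eps := (fa - c) / (r ^+ 2).
have r20 : 0 < r ^+ 2 by rewrite exprn_gt0.
have eps0 : 0 < eps by rewrite divr_gt0// subr_gt0 -lte_fin.
have epsr : eps * r ^+ 2 = fa - c by rewrite /eps mulfVK// lt0r_neq0.
have cRe : continuous (fun l : Cplx R => eps * (Re l * Re l)).
  move=> l; have Hl : (fun l : Cplx R => Re l) @ l --> Re l by exact: continuous_Re.
  have He : (cst eps : Cplx R -> R) @ l --> eps by exact: cst_continuous.
  exact: (@continuousM _ _ _ _ l He (@continuousM _ _ _ _ l Hl Hl)).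
have D00 : D0 0 by change (normc (0 : R[i]) <= r); rewrite ComplexField.Normc.normc0 ltW.
have [l0 Dl0 maxl] := usc_attains_max (@compact_normc_le R r) (ex_intro _ 0 D00)
  (uscD_continuous Ausc cRe).
have faW := le_trans A0 (_ : (A 0%R <= A l0 + (eps * (Re l0 * Re l0))%:E)%E).
have {}faW : (fa%:E <= A l0 + (eps * (Re l0 * Re l0))%:E)%E.
  by apply: faW; have := maxl 0 D00; rewrite /= mulr0 mulr0 adde0.
have AM : (A l0 <= M%:E)%E.
  rewrite -[leRHS]avg_cst; apply: le_avg => t _; exact/fM/rotD.
have [x Ax] : exists x : R, A l0 = x%:E.
  by move: AM faW; case: (A l0) => [x| |] // _ _; exists x.
have Re_r : Re l0 * Re l0 <= r ^+ 2.
  have /andP[h1 h2] : - r <= Re l0 <= r.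
    by rewrite -ler_norml; exact: le_trans (normc_Re _) Dl0.
  nra.
have [l0r|l0r] := eqVneq (normc l0) r.
  move: faW; rewrite Acirc// => faW.
  have := lt_le_trans Cc (lexx c%:E).
  move: faW; case: (avg _) => [y| |] //; rewrite -EFinD lee_fin => fay; rewrite lte_fin => yc.
  have : eps * (Re l0 * Re l0) <= eps * r ^+ 2 by rewrite ler_pM2l.
  lra.
have {}l0r : normc l0 < r by rewrite lt_neqAle l0r.
pose rho := Num.min (eta / 2) (r - normc l0).
have rho0 : 0 < rho by rewrite lt_min divr_gt0// subr_gt0.
have rhoe : rho < eta by rewrite gt_min; apply/orP; left; lra.
have rhor : normc l0 + rho <= r.
  have : rho <= r - normc l0 by rewrite ge_min lexx orbT.
  lra.
have := Asub l0 rho rho0 rhoe rhor; rewrite Ax leNgt => /negP; apply.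
(* Maximality at [l0] bounds [A] on the small circle by a function whose mean is x - eps * rho^2 /
   2, below the value x at the centre. *)
apply: (@le_lt_trans _ _ (avg (fun t =>
  (x + eps * (Re l0 * Re l0) + - eps * (Re l0 + rho * cos t + 0 * sin t) ^+ 2)%:E))).
  apply: le_avg => t _.
  have Dt : D0 (circle_point l0 rho t).
    rewrite /D0 /=; apply: le_trans rhor.
    rewrite -[X in normc X](subrK l0) addrC; apply: (le_trans (normcD_le _ _)).
    by rewrite lerD2l normc_circle_point// ltW.
  have := maxl _ Dt; rewrite Ax Re_circle_point => Wt.
  rewrite EFinD mulNr EFinN leeBrDr//; apply: le_trans Wt; rewrite leeD2l// lee_fin.
  by rewrite mul0r addr0 expr2.
rewrite avg_trig lte_fin.
have : 0 < eps * rho ^+ 2 by rewrite mulr_gt0// exprn_gt0.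
by lra.
Unshelve. all: by end_near.
Qed.

End LocalSubmean.

(** * Plurisubharmonic functions *)

Section Plurisubharmonic.
Context {R : realType} {n : nat}.
Implicit Types (Omega : set (Cvec R n)) (v f : Cvec R n -> \bar R).

Lemma line_bound (b : Cvec R n) : exists2 B : R, 0 < B &
  forall (l : Cplx R) i, normc (l * b 0 i) <= B * normc l.
Proof.
(* The summand 1 keeps the constant positive when [b] vanishes; radii are later divided by it. *)
exists (1 + \sum_i normc (b 0 i)).
  by rewrite ltr_pwDl// sumr_ge0// => i _; exact: normc_ge0.
move=> l i; rewrite ComplexField.Normc.normcM mulrC ler_wpM2r ?normc_ge0//.
rewrite (bigD1 i)//= addrCA lerDl addr_ge0// sumr_ge0// => j _; exact: normc_ge0.
Qed.

Lemma polydisc_line (a b : Cvec R n) (l l' : Cplx R) (e : R) :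
  (forall i, normc ((l' - l) * b 0 i) < e) ->
  polydisc (a + l *: b) e (a + l' *: b).
Proof.
move=> H i; have := H i; rewrite mulrBl !mxE.
by rewrite opprD addrACA subrr add0r.
Qed.

Lemma continuous_line (a b : Cvec R n) : continuous (fun l : Cplx R => a + l *: b).
Proof.
move=> l V /nbhs_polydiscP [e e0 eV]; have [B B0 HB] := line_bound b.
apply/nbhs_normcP; exists (e / B); first by rewrite divr_gt0.
move=> l' ll'; apply: eV; apply: polydisc_line => i.
by apply: (le_lt_trans (HB _ _)); rewrite mulrC -ltr_pdivlMr.
Qed.

Definition linear_circle (z b : Cvec R n) (r t : R) : Cvec R n :=
  z + circle_point 0 r t *: b.

Lemma linear_circleE (a b : Cvec R n) (l : Cplx R) (r t : R) :
  a + circle_point l r t *: b = linear_circle (a + l *: b) b r t.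
Proof. by rewrite /linear_circle !circle_pointE add0r scalerDl addrA. Qed.

Lemma normc_circle0 (r t : R) : 0 <= r -> normc (circle_point 0 r t) = r.
Proof. by move=> r0; rewrite -[X in normc X]subr0 normc_circle_point. Qed.

Definition disc_in Omega (z b : Cvec R n) (r : R) : Prop :=
  forall l : Cplx R, normc l <= r -> Omega (z + l *: b).

Lemma disc_in_circle Omega (z b : Cvec R n) (r t : R) : 0 <= r ->
  disc_in Omega z b r -> Omega (linear_circle z b r t).
Proof. by move=> r0 zb; apply: zb; rewrite normc_circle0. Qed.

(** The base point of a complex line is arbitrary, so each disc in the line may be recentred at its
    own midpoint; the one-variable conditions on all lines collapse into one inequality for discs
    centred at parameter 0. *)
Lemma plurisubharmonicP Omega v :
  plurisubharmonic Omega v <-> [/\ forall z, Omega z -> (v z < +oo)%E,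
    upper_semicontinuous_on Omega v &
    forall (z b : Cvec R n) (r : R), 0 < r -> disc_in Omega z b r ->
      (v z <= avg (fun t => v (linear_circle z b r t)))%E].
Proof.
split=> [[voo uv sv]|[voo uv sv]]; split=> //.
  move=> z b r r0 zb; have [_ _ /(_ 0 r r0)] := sv z b.
  rewrite scale0r addr0; apply=> l; rewrite /closed_disc /= subr0; exact: zb.
move=> a b; split.
- by move=> l; exact: voo.
- by apply: (usc_comp (A := Omega)) => //; exact: continuous_line.
- move=> l r r0 sD; apply: (le_trans (sv (a + l *: b) b r r0 _)).
    move=> m mr; rewrite -addrA -scalerDl; apply: sD.
    by rewrite /closed_disc /= addrC addKr.
  by apply: le_avg => t _; rewrite linear_circleE.
Qed.

Lemma measurable_linear_circle Omega v (z b : Cvec R n) (r : R) : 0 <= r ->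
  upper_semicontinuous_on Omega v -> disc_in Omega z b r ->
  measurable_fun setT (fun t => v (linear_circle z b r t)).
Proof.
move=> r0 uv zb.
apply: (@measurable_circle _ [set l | Omega (z + l *: b)] (fun l => v (z + l *: b)) 0 r) => //.
  by move=> l; rewrite /closed_disc /= subr0; exact: zb.
by apply: (usc_comp (A := Omega)) => //; exact: continuous_line.
Qed.

(** The closed disc is compact, so it keeps a uniform distance to the complement of [Omega], and
    small translates of it stay inside. *)
Lemma disc_in_open Omega (z b : Cvec R n) (r : R) : open Omega ->
  disc_in Omega z b r -> exists2 e : R, 0 < e &
  forall w, polydisc z e w -> disc_in Omega w b r.
Proof.
move=> oO zb.
pose K := (fun l : Cplx R => z + l *: b) @` [set l | normc l <= r].
have cK : compact K :=
  continuous_compact (continuous_subspaceT (@continuous_line z b)) (@compact_normc_le R r).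
have [|e e0 eS] := @compact_uniform R n K (fun _ y => Omega y) cK.
  move=> _ [l lr <-]; have /nbhs_polydiscP [e e0 eO] : nbhs (z + l *: b) Omega.
    by apply: open_nbhs_nbhs; split => //; exact: zb.
  by exists e => // x y _ ?; exact: eO.
exists e => // w zw l lr; apply: (eS (z + l *: b)); first by exists l.
by move=> i; rewrite !mxE opprD addrACA subrr addr0; exact: zw.
Qed.

(** This is [submean_of_local] on each line. Smallness is measured by [r * normc (b 0 i)], the size
    of the disc in space, because [r] alone changes when [b] is rescaled. *)
Lemma plurisubharmonic_local Omega v (eta : R) : 0 < eta ->
  (forall z, Omega z -> (v z < +oo)%E) -> upper_semicontinuous_on Omega v ->
  (forall (z b : Cvec R n) (r : R), 0 < r -> disc_in Omega z b r ->
    (forall i, r * normc (b 0 i) < eta) ->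
    (v z <= avg (fun t => v (linear_circle z b r t)))%E) ->
  plurisubharmonic Omega v.
Proof.
move=> eta0 voo uv sv; apply/plurisubharmonicP; split=> // z b r r0 zb.
have [B B0 HB] := line_bound b.
have Dsub l : closed_disc 0 r l -> Omega (z + l *: b).
  by rewrite /closed_disc /= subr0; exact: zb.
have := @submean_of_local R (fun l => v (z + l *: b)) 0 r (eta / B) r0.
rewrite scale0r addr0; apply.
- exact: divr_gt0.
- by apply: (usc_comp (A := Omega)) => //; exact: continuous_line.
- by move=> l Dl; apply/voo/Dsub.
move=> c rho rho0 rhoB; rewrite subr0 => crho.
rewrite (_ : (fun t => v (z + _ *: b)) = (fun t => v (linear_circle (z + c *: b) b rho t))); last first.
  by apply/funext => t; rewrite linear_circleE.
apply: sv => //.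
  move=> l lrho; rewrite -addrA -scalerDl; apply: zb.
  by apply: (le_trans (normcD_le _ _)); apply: le_trans crho; rewrite lerD2l.
move=> i; have := HB rho%:C%C i; rewrite ComplexField.Normc.normcM normc_real gtr0_norm//.
by move=> /le_lt_trans; apply; rewrite mulrC -ltr_pdivlMr.
Qed.

(** * Upper regularization of envelopes *)

Definition usc_reg Omega f : Cvec R n -> \bar R := fun z =>
  ereal_inf [set ereal_sup (f @` (Omega `&` polydisc z e)) | e in [set e : R | 0 < e]].

Lemma usc_reg_ge Omega f z : Omega z -> (f z <= usc_reg Omega f z)%E.
Proof.
move=> Oz; apply: le_ereal_inf_tmp => _ [e /= e0 <-].
by apply: ereal_sup_ubound; exists z => //; split => //; exact: polydisc_center.
Qed.

Lemma usc_reg_lt Omega f z (a : \bar R) : (usc_reg Omega f z < a)%E ->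
  exists2 e : R, 0 < e & forall w, Omega w -> polydisc z e w -> (f w < a)%E.
Proof.
move=> /ereal_inf_lt [_ [e /= e0 <-] ea]; exists e => // w Ow zw.
by apply: le_lt_trans ea; apply: ereal_sup_ubound; exists w.
Qed.

Lemma usc_reg_le Omega f z (a : \bar R) (e : R) : 0 < e ->
  (forall w, Omega w -> polydisc z e w -> (f w <= a)%E) -> (usc_reg Omega f z <= a)%E.
Proof.
move=> e0 fa; apply: (@le_trans _ _ (ereal_sup (f @` (Omega `&` polydisc z e)))).
  by apply: ereal_inf_lbound; exists e.
by apply: ge_ereal_sup => _ [w [Ow zw] <-]; exact: fa.
Qed.

Lemma usc_reg_gt Omega f z (a : \bar R) (e : R) : 0 < e -> (a < usc_reg Omega f z)%E ->
  exists w, [/\ Omega w, polydisc z e w & (a < f w)%E].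
Proof.
move=> e0 af; apply: contrapT => nw; move: af; apply/negP; rewrite -leNgt.
apply: (usc_reg_le e0) => w Ow zw; rewrite leNgt; apply/negP => aw; apply: nw.
by exists w.
Qed.

Lemma usc_reg_usc Omega f : upper_semicontinuous_on Omega (usc_reg Omega f).
Proof.
apply/uscP => z Oz a fa.
have [c fc ca] := lte_real_between fa.
have [e e0 He] := usc_reg_lt fc.
exists (e / 2) => [|w Ow zw]; first by rewrite divr_gt0.
apply: le_lt_trans ca; apply: (@usc_reg_le _ _ _ _ (e / 2)); first by rewrite divr_gt0.
move=> x Ox wx; apply/ltW/He => //; rewrite (splitr e); exact: polydisc_trans wx.
Qed.

(** If P*(z) > c, there are points w k tending to z and competitors exceeding c at them, so P* has
    mean at least c over the translated circle around each w k. Reverse Fatou, with the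
    semicontinuity of P*, passes this bound to the circle around z. *)
Lemma usc_reg_envelope_psh Omega f (M : R) : open Omega ->
  (forall z, Omega z -> (f z <= M%:E)%E) ->
  plurisubharmonic Omega (usc_reg Omega (Perron_Bremermann Omega f)).
Proof.
move=> oO fM; set P := Perron_Bremermann Omega f.
have PM z : Omega z -> (P z <= M%:E)%E.
  move=> Oz; apply: ge_ereal_sup => _ [v [_ vf] <-].
  exact: le_trans (vf z Oz) (fM z Oz).
have rM z : (usc_reg Omega P z <= M%:E)%E.
  by apply: (@usc_reg_le _ _ _ _ 1) => // w Ow _; exact: PM.
have uP := @usc_reg_usc Omega P.
apply/plurisubharmonicP; split=> //.
  by move=> z _; apply: le_lt_trans (rM z) _; rewrite ltry.
move=> z b r r0 zb; rewrite leNgt; apply/negP => /lte_real_between [c avgc cP].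
have [e e0 He] := disc_in_open oO zb.
have seq k : exists w, [/\ polydisc z (k.+1%:R^-1) w, disc_in Omega w b r &
    (c%:E <= avg (fun t => usc_reg Omega P (linear_circle w b r t)))%E].
  have m0 : 0 < Num.min e (k.+1%:R^-1) by rewrite lt_min e0 invr_gt0 ltr0n.
  have [w [Ow zw /ereal_sup_gt [_ [v [pv vf] <-] cv]]] := usc_reg_gt m0 cP.
  have wb : disc_in Omega w b r.
    by apply: He; apply: polydisc_le zw; rewrite ge_min lexx.
  exists w; split=> //; first by apply: polydisc_le zw; rewrite ge_min lexx orbT.
  have /plurisubharmonicP [_ _ sv] := pv.
  apply: (le_trans (ltW cv)); apply: (le_trans (sv w b r r0 wb)).
  apply: le_avg => t _; have Ot := disc_in_circle t (ltW r0) wb.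
  apply: le_trans (usc_reg_ge _ Ot).
  by apply: ereal_sup_ubound; exists v.
have [w Hw] := choice seq.
suff : (c%:E <= avg (fun t => usc_reg Omega P (linear_circle z b r t)))%E by rewrite leNgt avgc.
apply: (@avg_limsup_ge R (fun k t => usc_reg Omega P (linear_circle (w k) b r t)) _ M).
- by move=> k; have [_ wb _] := Hw k; apply: measurable_linear_circle uP wb; exact: ltW.
- by apply: measurable_linear_circle uP zb; exact: ltW.
- by move=> k t _; exact: rM.
- by move=> t _; exact: rM.
- move=> t a _ fa; have /uscP /(_ _ (disc_in_circle t (ltW r0) zb) a fa) [d d0 Hd] := uP.
  near=> k; have [zw wb _] := Hw k; apply: Hd; first exact: disc_in_circle (ltW r0) wb.
  move=> i; rewrite !mxE opprD addrACA subrr addr0; apply: (lt_trans (zw i)).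
  near: k; exact: near_infty_natSinv_lt (PosNum d0).
- by move=> k; have [] := Hw k.
Unshelve. all: by end_near.
Qed.

End Plurisubharmonic.

(** * Euclidean balls, their boundary points, and sums of continuous plurisubharmonic functions *)

Section PotentialTheory.
Context {R : realType} {n : nat}.
Implicit Types (Omega K : set (Cvec R n)).

Lemma euclidean_normZ (l : Cplx R) (z : Cvec R n) :
  euclidean_norm (l *: z) = normc l * euclidean_norm z.
Proof.
rewrite /euclidean_norm (_ : \sum_(i < n) normc ((l *: z) 0 i) ^+ 2 =
  normc l ^+ 2 * \sum_(i < n) normc (z 0 i) ^+ 2).
  by rewrite sqrtrM ?sqr_ge0// sqrtr_sqr ger0_norm ?normc_ge0.
rewrite mulr_sumr; apply: eq_bigr => i _.
by rewrite mxE ComplexField.Normc.normcM exprMn.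
Qed.

Lemma normc_le_euclidean_norm (z : Cvec R n) i : normc (z 0 i) <= euclidean_norm z.
Proof.
rewrite /euclidean_norm -[leLHS]ger0_norm ?normc_ge0// -sqrtr_sqr.
rewrite ler_sqrt ?sumr_ge0//; last by move=> j _; exact: sqr_ge0.
by rewrite (bigD1 i)//= lerDl sumr_ge0// => j _; exact: sqr_ge0.
Qed.

Lemma closure_euclidean_ball (c p : Cvec R n) (r : R) : 0 < r ->
  closure (euclidean_ball c r) p -> euclidean_norm (p - c) <= r.
Proof.
move=> r0 clp; rewrite leNgt; apply/negP => rp.
pose N := euclidean_norm (p - c).
have N2 : N ^+ 2 = \sum_(i < n) normc ((p - c) 0 i) ^+ 2.
  by rewrite sqr_sqrtr// sumr_ge0// => i _; exact: sqr_ge0.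
have gap : 0 < N ^+ 2 - r ^+ 2 by rewrite subr_gt0 ltr_pXn2r ?nnegrE ?ltW// (lt_trans r0).
(* Moving a coordinate by d <= 1 raises its squared modulus by at most d * (2 r + 1); summing over
   the n coordinates gives this factor. The final 1 keeps [D] positive when n = 0. *)
pose D := n%:R * (2 * r + 1) + 1.
have D0 : 0 < D.
  by rewrite /D ltr_wpDl// mulr_ge0 ?ler0n//; lra.
pose d := Num.min 1 ((N ^+ 2 - r ^+ 2) / D).
have d0 : 0 < d by rewrite lt_min ltr01 divr_gt0.
have [w [wB pw]] := clp _ (proj2 (nbhs_polydiscP p (polydisc p d)) (ex_intro2 _ _ d d0 (@subset_refl _ _))).
have w2 : \sum_(i < n) normc ((w - c) 0 i) ^+ 2 < r ^+ 2.
  rewrite -[ltLHS]sqr_sqrtr; last by rewrite sumr_ge0// => i _; exact: sqr_ge0.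
  by rewrite ltr_pXn2r// ?nnegrE ?sqrtr_ge0// ltW.
have step i : normc ((p - c) 0 i) ^+ 2 <= normc ((w - c) 0 i) ^+ 2 + d * (2 * r + 1).
  have h1 : normc ((p - c) 0 i) <= normc ((w - c) 0 i) + d.
    rewrite (_ : (p - c) 0 i = (p 0 i - w 0 i) + (w - c) 0 i).
      apply: (le_trans (normcD_le _ _)); by rewrite [leRHS]addrC lerD2r normc_distC ltW.
    by rewrite !mxE addrA subrK.
  have h2 := le_lt_trans (normc_le_euclidean_norm (w - c) i) wB.
  have h3 := normc_ge0 ((w - c) 0 i); have h4 := normc_ge0 ((p - c) 0 i).
  have d1 : d <= 1 by rewrite ge_min lexx.
  nra.
have : N ^+ 2 <= \sum_(i < n) (normc ((w - c) 0 i) ^+ 2 + d * (2 * r + 1)).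
  by rewrite N2; apply: ler_sum => i _; exact: step.
rewrite big_split /= sumr_const card_ord -mulr_natl.
have : d * D <= N ^+ 2 - r ^+ 2 by rewrite -ler_pdivlMr// ge_min lexx orbT.
by rewrite /D; lra.
Qed.

(* A ball is not thin at its boundary points: the arc cos t >= 1/4 of every
   small circle around p in the complex line through p and c lies in the ball.
   The indicator of that arc is replaced by (cos t - 1/4)(cos t + 1), which is
   at most 0 off the arc and has positive mean 1/4. *)
Lemma psh_le_at_ball_boundary Omega (v : Cvec R n -> \bar R) (c p : Cvec R n) (r A : R) :
  open Omega -> plurisubharmonic Omega v -> Omega p ->
  0 < r -> euclidean_norm (p - c) <= r ->
  (forall e, 0 < e -> exists2 d : R, 0 < d & forall w, euclidean_ball c r w ->
     polydisc p d w -> (v w <= (A + e)%:E)%E) ->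
  (v p <= A%:E)%E.
Proof.
move=> oO /plurisubharmonicP [voo uv sv] Op r0 pr near_ball.
rewrite leNgt; apply/negP => Av.
have [S vS] : exists S : R, v p = S%:E.
  by move: Av (voo p Op); case: (v p) => [S| |] // _ _; exists S.
move: Av; rewrite vS lte_fin => AS.
pose k := (S - A) / 12; have k0 : 0 < k by rewrite divr_gt0 ?subr_gt0.
have [d1 d10 Hd1] := near_ball k k0.
have /uscP /(_ p Op (S + k)) := uv; rewrite vS lte_fin ltrDl => /(_ k0) [d2 d20 Hd2].
have /nbhs_polydiscP [d3 d30 Hd3] : nbhs p Omega by exact: open_nbhs_nbhs.
pose b := c - p; have [B B0 HB] := line_bound b.
pose d := Num.min d1 (Num.min d2 d3).
have d0 : 0 < d by rewrite !lt_min d10 d20 d30.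
(* A radius at most 1/4 puts the arc in the ball: |1 - rho e^(it)|^2 = 1 - 2 rho cos t + rho^2 < 1
   when cos t >= 1/4. The other bound keeps the circle in the polydisc of radius [d]. *)
pose rho := Num.min (1 / 4) (d / (2 * B)).
have rho0 : 0 < rho by rewrite lt_min !divr_gt0// mulr_gt0.
have rho4 : rho <= 1 / 4 by rewrite ge_min lexx.
have Brho : B * rho < d.
  have : rho <= d / (2 * B) by rewrite ge_min lexx orbT.
  rewrite ler_pdivlMr ?mulr_gt0//; lra.
have near_p l : normc l <= rho -> polydisc p d (p + l *: b).
  move=> lrho i; rewrite !mxE (addrC (p 0 i)) addrK; apply: le_lt_trans Brho.
  by have := HB l i; rewrite !mxE => /le_trans; apply; rewrite ler_pM2l.
have din : disc_in Omega p b rho.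
  by move=> l /near_p lp; apply: Hd3; apply: polydisc_le lp; rewrite !ge_min lexx !orbT.
have := sv p b rho rho0 din; rewrite vS leNgt => /negP; apply.
(* The comparison function is S + k + e (cos t - 1/4)(cos t + 1). The product is at most 3/2, so
   this [e] leaves the function at least A + k on the arc, while its mean is S + k - (S - A) / 6 = S
   - k. *)
pose e := - (S - A) * (2 / 3).
apply: (@le_lt_trans _ _ (avg (fun t =>
  (S + k - e * (25 / 64) + e * (3 / 8 + 1 * cos t + 0 * sin t) ^+ 2)%:E))); last first.
  by rewrite avg_trig lte_fin /e /k; lra.
apply: le_avg => t _; rewrite mul0r addr0 mul1r.
have cr := normc_circle0 t (ltW rho0).
have pt : polydisc p d (linear_circle p b rho t) by apply: near_p; rewrite cr.
have cos1 := cos_le1 t; have cosN1 := cos_geN1 t.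
have SA : 0 < S - A by rewrite subr_gt0.
have [ct|ct] := leP (1 / 4) (cos t).
  apply: (@le_trans _ _ (A + k)%:E).
    apply: Hd1; last by apply: polydisc_le pt; rewrite ge_min lexx.
    rewrite /euclidean_ball /= /linear_circle.
    rewrite (_ : _ - c = (1 - circle_point 0 rho t) *: (p - c)); last first.
      by rewrite scalerBl scale1r /b -(opprB p c) scalerN addrAC.
    rewrite euclidean_normZ.
    have n1 : normc (1 - circle_point 0 rho t) < 1.
      rewrite /circle_point add0r /= -[ltRHS]sqrtr1 ltr_sqrt// sub0r sqrrN.
      have := cos2Dsin2 t; nra.
    apply: (@le_lt_trans _ _ (normc (1 - circle_point 0 rho t) * r)).
      by rewrite ler_wpM2l ?normc_ge0.
    by rewrite -[ltRHS]mul1r ltr_pM2r.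
  rewrite lee_fin /e.
  have : (cos t - 1 / 4) * (cos t + 1) <= 3 / 2 by nra.
  nra.
apply: (@le_trans _ _ (S + k)%:E).
  apply/ltW/Hd2; first by apply: din; rewrite cr.
  by apply: polydisc_le pt; rewrite !ge_min lexx !orbT.
rewrite lee_fin /e.
have : (cos t - 1 / 4) * (cos t + 1) <= 0 by nra.
nra.
Qed.

Lemma within_continuous_usc (A : set (Cvec R n)) (f : Cvec R n -> R) :
  {within A, continuous f} -> upper_semicontinuous_on A (EFin \o f).
Proof.
move=> /within_continuousP cf; apply/uscP => z Az a; rewrite lte_fin => fa.
have [|d d0 Hd] := cf z Az (a - f z); first by rewrite subr_gt0.
exists d => // w Aw zw; have := Hd w Aw zw; rewrite ltr_norml lte_fin; lra.
Qed.

Lemma within_continuous_subset (A B : set (Cvec R n)) (f : Cvec R n -> R) :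
  A `<=` B -> {within B, continuous f} -> {within A, continuous f}.
Proof. by move=> AB; exact: continuous_subspaceW. Qed.

Lemma within_continuous_lin (A : set (Cvec R n)) (f g : Cvec R n -> R) (c : R) :
  {within A, continuous f} -> {within A, continuous g} ->
  {within A, continuous (fun z => f z + c * g z)}.
Proof.
move=> cf cg z; apply: cvgD; first exact: cf.
by apply: cvgM; [exact: cvg_cst|exact: cg].
Qed.

Lemma closed_within_le (A : set (Cvec R n)) (f g : Cvec R n -> R) : closed A ->
  {within A, continuous f} -> {within A, continuous g} ->
  closed [set z | A z /\ f z <= g z].
Proof.
move=> cA /within_continuousP cf /within_continuousP cg.
rewrite -openC openE => z /= nz.
have [Az|nAz] := pselect (A z); last first.
  have : nbhs z (~` A) by apply: open_nbhs_nbhs; split => //; exact: closed_openC.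
  by apply: filterS => w nAw [].
have gf : g z < f z by rewrite ltNge; apply/negP => fg; apply: nz.
have e0 : 0 < (f z - g z) / 2 by lra.
have [d d0 Hd] := cf z Az _ e0; have [d' d'0 Hd'] := cg z Az _ e0.
apply/nbhs_polydiscP; exists (Num.min d d'); first by rewrite lt_min d0 d'0.
move=> w zw [Aw fgw].
have := Hd w Aw (polydisc_le (_ : _ <= d) zw); rewrite ge_min lexx => /(_ isT).
have := Hd' w Aw (polydisc_le (_ : _ <= d') zw); rewrite ge_min lexx orbT => /(_ isT).
by rewrite !ltr_norml; lra.
Qed.

Lemma continuous_linear_circle (z b : Cvec R n) (r : R) : continuous (linear_circle z b r).
Proof.
move=> t; exact: (@continuous_comp _ _ _ (circle_point 0 r) (fun l : Cplx R => z + l *: b) t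
  (@continuous_circle_point R 0 r t) (@continuous_line R n z b _)).
Qed.

Lemma continuous_on_circle Omega (f : Cvec R n -> R) (z b : Cvec R n) (r : R) :
  0 <= r -> {within Omega, continuous f} -> open Omega -> disc_in Omega z b r ->
  continuous (fun t => f (linear_circle z b r t)).
Proof.
move=> r0 cf oO zb t; apply: continuous_comp; first exact: continuous_linear_circle.
have := continuous_open_subspace f oO; rewrite propeqE => -[+ _] => /(_ cf); apply.
by rewrite inE; exact: disc_in_circle.
Qed.

Lemma psh_lin Omega (f g : Cvec R n -> R) (c : R) : open Omega -> 0 <= c ->
  {within Omega, continuous f} -> {within Omega, continuous g} ->
  plurisubharmonic Omega (EFin \o f) -> plurisubharmonic Omega (EFin \o g) ->
  plurisubharmonic Omega (EFin \o (fun z => f z + c * g z)).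
Proof.
move=> oO c0 cf cg /plurisubharmonicP [_ _ sf] /plurisubharmonicP [_ _ sg].
apply/plurisubharmonicP; split.
- by move=> z _; rewrite ltry.
- by apply: within_continuous_usc; exact: within_continuous_lin.
- move=> z b r r0 zb; rewrite /= avg_continuousD.
  + rewrite EFinD EFinM; apply: leeD; first exact: sf.
    by apply: lee_wpmul2l; [rewrite lee_fin|exact: sg].
  + exact: continuous_on_circle (ltW r0) cf oO zb.
  + exact: continuous_on_circle (ltW r0) cg oO zb.
Qed.

Lemma compact_closure_bounded Omega : bounded Omega -> compact (closure Omega).
Proof.
move=> [M OM]; apply: (@bounded_closed_compactC R n _ (M + 1)); last exact: closed_closure.
move=> z clz i.
have [w [Ow zw]] := clz _ (proj2 (nbhs_polydiscP z (polydisc z 1)) (ex_intro2 _ _ 1 ltr01 (@subset_refl _ _))).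
have := le_trans (normc_le_euclidean_norm w i) (OM w Ow).
have := zw i; rewrite normc_distC => zwi.
have := normcD_le (z 0 i - w 0 i) (w 0 i); rewrite subrK; lra.
Qed.

Lemma bdryE Omega z : open Omega -> bdry Omega z <-> closure Omega z /\ ~ Omega z.
Proof. by move=> /interior_id oO; rewrite /bdry /setD /= oO. Qed.

End PotentialTheory.

(** * The boundary barrier *)

Section Barrier.
Context {R : realType} {m : nat}.
Local Notation n := m.+1.
Implicit Types (Omega K : set (Cvec R n)).

Let x1 (z : Cvec R n) : R := Re (z 0 0).

Lemma linear_circle_Re1 (z b : Cvec R n) (r t : R) :
  x1 (linear_circle z b r t) =
  x1 z + r * Re (b 0 0) * cos t + (- (r * Im (b 0 0))) * sin t.
Proof.
rewrite /x1 /linear_circle !mxE /circle_point add0r.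
by case: (z 0 0) (b 0 0) => [x y] [p q] /=; ring.
Qed.

Lemma continuous_Re1_sqr : continuous (fun z : Cvec R n => x1 z ^+ 2).
Proof.
have c1 : continuous x1.
  move=> z; apply: (@continuous_comp _ _ _ (fun z : Cvec R n => z 0 0) (fun a : Cplx R => Re a)).
    exact: coord_continuous.
  exact: continuous_Re.
move=> z; exact: (@continuousM _ _ _ _ z (c1 z) (c1 z)).
Qed.

(** On a circle in direction [b] the mean exceeds the central value by r^2 |b_0|^2 / 2. The growth
    is strict along the first coordinate, hence a dimension of the form [m.+1]. *)
Lemma psh_Re1_sqr Omega : plurisubharmonic Omega (fun z => (x1 z ^+ 2)%:E).
Proof.
apply/plurisubharmonicP; split.
- by move=> z _; rewrite ltry.
- apply: (@within_continuous_usc R n Omega (fun z => x1 z ^+ 2)).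
  by apply: continuous_subspaceT; exact: continuous_Re1_sqr.
- move=> z b r r0 zb.
  under eq_fun do rewrite linear_circle_Re1.
  have := avg_trig 0 1 (x1 z) (r * Re (b 0 0)) (- (r * Im (b 0 0))).
  under eq_fun do rewrite add0r mul1r.
  move=> ->; rewrite lee_fin add0r mul1r lerDl divr_ge0// addr_ge0 ?sqr_ge0//.
Qed.

Lemma psh_cst Omega (c : R) : plurisubharmonic Omega (fun=> c%:E).
Proof.
apply/plurisubharmonicP; split.
- by move=> z _; rewrite ltry.
- apply: (@within_continuous_usc R n Omega (fun=> c)).
  by apply: continuous_subspaceT; exact: cst_continuous.
- by move=> z b r _ _; rewrite avg_cst.
Qed.

(** Extend the boundary function -(Re z_0)^2 to a plurisubharmonic g and add (Re z_0)^2. The sum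
    vanishes on the boundary and is strictly subharmonic along the first coordinate, so it has no
    interior maximum and is negative inside. *)
Lemma B_regular_exhaustion Omega : B_regular Omega ->
  exists psi : Cvec R n -> R, [/\ {within closure Omega, continuous psi},
    plurisubharmonic Omega (EFin \o psi),
    forall z, bdry Omega z -> psi z = 0,
    forall z, closure Omega z -> psi z <= 0 &
    forall z, Omega z -> psi z < 0].
Proof.
move=> [[oO cO O0] bO extO].
have cclO := compact_closure_bounded bO.
have cq : {within closure Omega, continuous (fun z => x1 z ^+ 2)}.
  by apply: continuous_subspaceT; exact: continuous_Re1_sqr.
have [|g [pg cg gb]] := extO (fun z => - (x1 z ^+ 2)).
  apply: continuous_subspaceT => z; exact: (continuousN (@continuous_Re1_sqr z)).
pose psi z := g z + 1 * x1 z ^+ 2.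
have cpsi : {within closure Omega, continuous psi} by exact: within_continuous_lin.
have sub := @subset_closure _ Omega.
have no_max z0 : Omega z0 -> ~ (forall z, closure Omega z -> psi z <= psi z0).
  move=> Oz0 maxz.
  have /nbhs_polydiscP [d d0 Hd] : nbhs z0 Omega by exact: open_nbhs_nbhs.
  pose b : Cvec R n := delta_mx 0 0.
  have d20 : 0 < d / 2 by rewrite divr_gt0.
  have din : disc_in Omega z0 b (d / 2).
    move=> l ld; apply: Hd => i; rewrite !mxE addrAC subrr add0r eqxx /=.
    case: (i == 0); rewrite ?mulr1 ?mulr0 ?ComplexField.Normc.normc0//.
    by apply: (le_lt_trans ld); lra.
  have /plurisubharmonicP [_ _ sg] := pg.
  have := sg z0 b (d / 2) d20 din; rewrite leNgt => /negP; apply.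
  (* At an interior maximum z0, g is at most psi(z0) - (Re z_0)^2 on the circle, and the mean of
     this bound is g(z0) - (d/2)^2 / 2. *)
  apply: (@le_lt_trans _ _ (avg (fun t =>
    (psi z0 + -1 * (x1 z0 + d / 2 * cos t + 0 * sin t) ^+ 2)%:E))).
    apply: le_avg => t _; rewrite /= lee_fin.
    have := maxz _ (sub _ (disc_in_circle t (ltW d20) din)).
    have bE : b 0 0 = 1 by rewrite mxE !eqxx.
    rewrite {1}/psi linear_circle_Re1 bE /= mulr1 mulr0 oppr0; lra.
  rewrite avg_trig lte_fin /psi.
  have : 0 < (d / 2) ^+ 2 by rewrite exprn_gt0.
  lra.
have [z1 Oz1] := O0.
have [z0 clz0 maxz0] := usc_attains_max cclO (ex_intro _ z1 (sub _ Oz1)) (within_continuous_usc cpsi).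
have {}maxz0 z : closure Omega z -> psi z <= psi z0 by move=> /maxz0; rewrite lee_fin.
have psib z : bdry Omega z -> psi z = 0 by move=> bz; rewrite /psi gb// mul1r addNr.
have psi0 z : closure Omega z -> psi z <= 0.
  move=> /maxz0 /le_trans; apply.
  have [Oz0|nOz0] := pselect (Omega z0); first by case: (no_max z0 Oz0).
  by rewrite psib//; apply/bdryE.
exists psi; split=> //.
- apply: psh_lin => //; [exact: within_continuous_subset sub cg|
    exact: within_continuous_subset sub cq|exact: psh_Re1_sqr].
- move=> z Oz; rewrite lt_neqAle psi0 ?andbT; last exact: sub.
  apply/eqP => pz; apply: (no_max z Oz) => w clw; rewrite pz; exact: psi0.
Qed.

(** The function is v + C psi - eps, with v the extension of the boundary values of h. Off [K1]
    already v - eps < h, and psi <= 0 preserves this. The set [K1] is compact in [Omega] because v -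
    eps < h on the boundary, so psi is bounded away from 0 there and a large C pushes the function
    below [F]. *)
Lemma envelope_barrier Omega K (h : Cvec R n -> R) (F : Cvec R n -> \bar R) (M eps : R) :
  B_regular Omega -> {within closure Omega, continuous h} ->
  compact K -> K `<=` Omega ->
  (forall z, Omega z -> ~ K z -> F z = (h z)%:E) ->
  (forall z, K z -> ((- M)%:E <= F z)%E) -> 0 < eps ->
  exists b : Cvec R n -> R, [/\ plurisubharmonic Omega (EFin \o b),
    {within closure Omega, continuous b},
    forall z, Omega z -> ((b z)%:E <= F z)%E &
    forall z, bdry Omega z -> h z - eps <= b z].
Proof.
move=> rO ch cK KO Fh FM eps0; have [[oO _ _] bO extO] := rO.
have cclO := compact_closure_bounded bO.
have sub := @subset_closure _ Omega.
have [psi [cpsi ppsi psi0 psi_le0 psi_lt0]] := B_regular_exhaustion rO.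
have cc (c : R) : {within closure Omega, continuous (fun=> c : R)}.
  by apply: continuous_subspaceT; exact: cst_continuous.
have bdry_sub : bdry Omega `<=` closure Omega by move=> z [].
have [v [pv cv vb]] := extO h (within_continuous_subset bdry_sub ch).
pose v' z := v z + 1 * - eps.
have cv' : {within closure Omega, continuous v'} by exact: within_continuous_lin.
pose K1 := [set z | closure Omega z /\ h z <= v' z] `|` K.
have cK1 : compact K1.
  apply: compactU => //; apply: (subclosed_compact _ cclO); last by move=> z [].
  by apply: closed_within_le => //; exact: closed_closure.
have K1O : K1 `<=` Omega.
  move=> z [[clz hv]|/KO//]; apply: contrapT => nOz.
  by move: hv; rewrite /v' vb; [lra|apply/bdryE].
have [Mv vM] : exists Mv : R, forall z, closure Omega z -> v z <= Mv.
  have [Mv vM] := usc_bounded cclO (within_continuous_usc cv) (fun z _ => ltry _).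
  by exists Mv => z /vM; rewrite lee_fin.
have [Mh hM] : exists Mh : R, forall z, closure Omega z -> - Mh <= h z.
  have cNh : {within closure Omega, continuous (fun z => 0 + -1 * h z)}.
    exact: within_continuous_lin.
  have [Mh hM] := usc_bounded cclO (within_continuous_usc cNh) (fun z _ => ltry _).
  by exists Mh => z /hM; rewrite lee_fin; lra.
(* Subtracting T brings v below both -M and -Mh, the lower bounds of [F] on [K] and of [h]. *)
pose T := `|Mv| + `|M| + `|Mh|.
have T0 : 0 <= T by rewrite /T !addr_ge0.
have [C C0 psiC] : exists2 C : R, 0 <= C & forall z, K1 z -> C * psi z <= - T.
  have [[z1 K1z1]|nK1] := pselect (K1 !=set0); last first.
    by exists 0 => // z K1z; case: nK1; exists z.
  have [z2 K1z2 max2] := usc_attains_max cK1 (ex_intro _ z1 K1z1)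
    (within_continuous_usc (within_continuous_subset (subset_trans K1O sub) cpsi)).
  have p0 := psi_lt0 _ (K1O _ K1z2).
  (* The point [z2] maximizes psi on [K1], where psi < 0, so this C works at every other point
     too. *)
  exists (T / - psi z2) => [|z /max2]; first by rewrite divr_ge0// oppr_ge0 ltW.
  rewrite lee_fin => zz2.
  have -> : - T = T / - psi z2 * psi z2.
    by rewrite invrN mulrN mulNr mulfVK// lt_eqF.
  by rewrite ler_wpM2l// divr_ge0// oppr_ge0 ltW.
pose b z := v z + C * psi z + 1 * - eps.
exists b; split.
- apply: psh_lin => //.
  + by apply: within_continuous_lin; [exact: within_continuous_subset cv|
      exact: within_continuous_subset cpsi].
  + exact: within_continuous_subset (cc _).
  + apply: psh_lin => //; [exact: within_continuous_subset cv|
      exact: within_continuous_subset cpsi].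
  + exact: psh_cst.
- by apply: within_continuous_lin => //; exact: within_continuous_lin.
- move=> z Oz; have clz := sub _ Oz.
  have hMz := hM z clz; have vMz := vM z clz.
  have nMv := ler_norm Mv; have nM := ler_norm M; have nMh := ler_norm Mh.
  have nMv' := normr_ge0 Mv; have nM' := normr_ge0 M; have nMh' := normr_ge0 Mh.
  have [Kz|nKz] := pselect (K z).
    apply: le_trans (FM z Kz); rewrite lee_fin /b.
    have := psiC z (or_intror Kz); rewrite /T; lra.
  rewrite Fh// lee_fin /b.
  have [hv|vh] := leP (h z) (v' z).
    have := psiC z (or_introl (conj clz hv)); rewrite /T; lra.
  have := psi_le0 z clz; move: vh; rewrite /v'; nra.
- by move=> z bz; rewrite /b vb// psi0//; lra.
Qed.

End Barrier.

(** * Continuity of the envelope *)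

Section Envelope.
Context {R : realType} {n : nat}.
Context (Omega Omega' : set (Cvec R n)) (h : Cvec R n -> R) (u : Cvec R n -> \bar R).
Context (oO : open Omega) (bO : bounded Omega) (oO' : open Omega').
Context (cK : compact (closure Omega')) (KO : closure Omega' `<=` Omega).
Context (ballO' : interior_ball_condition Omega').
Context (ch : {within closure Omega, continuous h}).
Context (pu : plurisubharmonic Omega u).
Context (uh : forall z, Omega z -> (u z <= (h z)%:E)%E).
Context (ufin : forall z, closure Omega' z -> u z \is a fin_num).
Context (cu : {within closure Omega', continuous (fine \o u)}).

Local Notation K := (closure Omega').
Local Notation F := (glued h u Omega').
Local Notation P := (Perron_Bremermann Omega F).

Lemma glued_in z : K z -> F z = u z.
Proof. by move=> Kz; rewrite /glued mem_set. Qed.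

Lemma glued_out z : ~ K z -> F z = (h z)%:E.
Proof. by move=> Kz; rewrite /glued memNset. Qed.

Lemma le_u_glued z : Omega z -> (u z <= F z)%E.
Proof. by move=> Oz; rewrite /glued; case: ifP => // _; exact: uh. Qed.

Lemma le_glued_h z : Omega z -> (F z <= (h z)%:E)%E.
Proof. by move=> Oz; rewrite /glued; case: ifP => // _; exact: uh. Qed.

Lemma le_u_envelope z : Omega z -> (u z <= P z)%E.
Proof.
move=> Oz; apply: ereal_sup_ubound; exists u => //; split => // w; exact: le_u_glued.
Qed.

Lemma le_envelope_glued z : Omega z -> (P z <= F z)%E.
Proof. by move=> Oz; apply: ge_ereal_sup => _ [v [_ vF] <-]; exact: vF. Qed.

Lemma envelope_in z : K z -> P z = u z.
Proof.
move=> Kz; apply/eqP; rewrite eq_le le_u_envelope ?andbT; last exact: KO.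
by rewrite -glued_in// le_envelope_glued//; exact: KO.
Qed.

Lemma bounded_h : exists M : R, forall z, closure Omega z -> h z <= M.
Proof.
have [M hM] := usc_bounded (compact_closure_bounded bO) (within_continuous_usc ch)
  (fun z _ => ltry _).
by exists M => z /hM; rewrite lee_fin.
Qed.

(** Inside Omega' the envelope is the continuous u; off [K] it is at most h on a whole
    neighbourhood, and h is continuous. At a boundary point of Omega' only approach from inside is
    controlled, and the interior ball turns that control into a bound at the point itself. *)
Lemma usc_reg_envelope_le z : Omega z -> (usc_reg Omega P z <= F z)%E.
Proof.
move=> Oz; have sub := @subset_closure _ Omega; have sub' := @subset_closure _ Omega'.
have inner w : Omega' w -> (usc_reg Omega P w <= u w)%E.
  move=> O'w; have Kw := sub' _ O'w.
  rewrite leNgt; apply/negP => /lte_real_between [c uc].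
  rewrite ltNge => /negP; apply.
  have /nbhs_polydiscP [d d0 Hd] : nbhs w Omega' by exact: open_nbhs_nbhs.
  move: uc; rewrite -(fineK (ufin Kw)) lte_fin -subr_gt0 => uc.
  have /within_continuousP /(_ w Kw _ uc) [d' d'0 Hd'] := cu.
  apply: (@usc_reg_le _ _ _ _ _ _ (Num.min d d')); first by rewrite lt_min d0 d'0.
  move=> x Ox wx.
  have O'x : Omega' x by apply: Hd; apply: polydisc_le wx; rewrite ge_min lexx.
  have Kx := sub' _ O'x.
  rewrite envelope_in// -(fineK (ufin Kx)) lee_fin.
  have := Hd' x Kx (polydisc_le _ wx); rewrite ge_min lexx orbT => /(_ isT).
  by rewrite /= ltr_norml; lra.
have [Kz|nKz] := pselect (K z); last first.
  rewrite glued_out// leNgt; apply/negP => /lte_real_between [c hc].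
  rewrite ltNge => /negP; apply; move: hc; rewrite lte_fin -subr_gt0 => hc.
  have /within_continuousP /(_ z (sub _ Oz) _ hc) [d d0 Hd] := ch.
  apply: (usc_reg_le d0) => w Ow zw; apply: (le_trans (le_envelope_glued Ow)).
  apply: (le_trans (le_glued_h Ow)); rewrite lee_fin.
  by have := Hd w (sub _ Ow) zw; rewrite ltr_norml; lra.
rewrite glued_in//; have [inz|ninz] := pselect (Omega' z); first exact: inner.
have [|c [r [r0 bO' bz]]] := ballO' (p := z); first by apply/bdryE.
have [M hM] := bounded_h.
have pP : plurisubharmonic Omega (usc_reg Omega P).
  apply: (@usc_reg_envelope_psh R n Omega F M oO) => w Ow.
  by apply: (le_trans (le_glued_h Ow)); rewrite lee_fin; exact/hM/sub.
rewrite -(fineK (ufin Kz)); apply: (psh_le_at_ball_boundary oO pP Oz r0).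
  by have [clz _] := bz; exact: (closure_euclidean_ball r0 clz).
move=> e e0; have /within_continuousP /(_ z Kz e e0) [d d0 Hd] := cu.
exists d => // w /bO' O'w zw; apply: (le_trans (inner w O'w)).
have Kw := sub' _ O'w; rewrite -(fineK (ufin Kw)) lee_fin.
by have := Hd w Kw zw; rewrite /= ltr_norml; lra.
Qed.

Lemma envelope_psh : plurisubharmonic Omega P.
Proof.
have sub := @subset_closure _ Omega.
have [M hM] := bounded_h.
have pP : plurisubharmonic Omega (usc_reg Omega P).
  apply: (@usc_reg_envelope_psh R n Omega F M oO) => w Ow.
  by apply: (le_trans (le_glued_h Ow)); rewrite lee_fin; exact/hM/sub.
have PE z : Omega z -> usc_reg Omega P z = P z.
  move=> Oz; apply/eqP; rewrite eq_le usc_reg_ge// andbT.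
  by apply: ereal_sup_ubound; exists (usc_reg Omega P) => //; split => // w; exact: usc_reg_envelope_le.
have /plurisubharmonicP [Poo uP sP] := pP.
apply/plurisubharmonicP; split.
- by move=> z Oz; rewrite -PE//; exact: Poo.
- move=> z Oz a; rewrite -PE// => Pa.
  have H : nbhs z [set w | Omega w -> (usc_reg Omega P w < a%:E)%E] := uP z Oz a Pa.
  change (nbhs z [set w | Omega w -> (P w < a%:E)%E]).
  by apply: filterS H => w H Ow; rewrite -PE//; exact: H.
- move=> z b r r0 zb; rewrite -PE; last by have := zb 0; rewrite scale0r addr0 ComplexField.Normc.normc0; apply; exact: ltW.
  apply: (le_trans (sP z b r r0 zb)); apply: le_avg => t _.
  by rewrite PE//; exact: disc_in_circle (ltW r0) zb.
Qed.

(* The translate P(. + w) - 5 e, glued to P outside the compact set where the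
   barrier b lies below h - 2 e, competes in the definition of P. *)
Lemma envelope_uniformly_continuous (b : Cvec R n -> R) (e : R) : 0 < e ->
  plurisubharmonic Omega (EFin \o b) -> {within closure Omega, continuous b} ->
  (forall z, Omega z -> ((b z)%:E <= F z)%E) ->
  (forall z, bdry Omega z -> h z - e <= b z) ->
  exists2 d : R, 0 < d & forall z z', Omega z -> Omega z' -> polydisc z d z' ->
    (P z' <= P z + (5 * e)%:E)%E.
Proof.
move=> e0 pb cb bF bh.
have sub := @subset_closure _ Omega.
have cclO := compact_closure_bounded bO.
have [M hM] := bounded_h.
have /plurisubharmonicP [Poo uP sP] := envelope_psh.
have bP z : Omega z -> ((b z)%:E <= P z)%E.
  by move=> Oz; apply: ereal_sup_ubound; exists (EFin \o b).
have Ph z : Omega z -> (P z <= (h z)%:E)%E.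
  by move=> Oz; exact: le_trans (le_envelope_glued Oz) (le_glued_h Oz).
have cc (c : R) : {within closure Omega, continuous (fun=> c : R)}.
  by apply: continuous_subspaceT; exact: cst_continuous.
(* On the boundary b >= h - e > h - 2 e, so the set where b <= h - 2 e is closed and misses the
   boundary: it is compact in [Omega]. *)
pose h2 z := h z + 1 * (- (2 * e)).
have ch2 : {within closure Omega, continuous h2} by exact: within_continuous_lin.
pose K0 := [set z | closure Omega z /\ b z <= h2 z].
have clK0 : closed K0 by apply: closed_within_le => //; exact: closed_closure.
have cK0 : compact K0 by apply: (subclosed_compact clK0 cclO) => z [].
have K0O : K0 `<=` Omega.
  move=> z [clz bz]; apply: contrapT => nOz.
  have := bh z ((bdryE z oO).2 (conj clz nOz)); move: bz; rewrite /h2; lra.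
have [d1 d10 Hd1] : exists2 d : R, 0 < d & forall x y, closure Omega x ->
    polydisc x d y -> closure Omega y -> `|h y - h x| < e.
  have [|d d0 Hd] := @compact_uniform R n (closure Omega)
    (fun x y => closure Omega x -> closure Omega y -> `|h y - h x| < e) cclO.
    move=> z clz; have e20 : 0 < e / 2 by rewrite divr_gt0.
    have /within_continuousP /(_ z clz _ e20) [d d0 Hd] := ch.
    exists d => // x y zx zy clx cly; have := Hd x clx zx; have := Hd y cly zy.
    by rewrite !ltr_norml; lra.
  exists d; first exact: d0.
  by move=> x y clx xy; exact: (Hd x y clx xy clx).
(* Upper semicontinuity of [P] at a point z of [K], with P = u there, bounds [P] near z by u(z) +
   e/2; continuity of u on [K] replaces u(z) by u(x). *)
have [d2 d20 Hd2] : exists2 d : R, 0 < d & forall x y, K x ->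
    polydisc x d y -> Omega y -> (P y <= u x + e%:E)%E.
  have [|d d0 Hd] := @compact_uniform R n K
    (fun x y => K x -> Omega y -> (P y <= u x + e%:E)%E) cK.
    move=> z Kz; have e20 : 0 < e / 2 by rewrite divr_gt0.
    have /within_continuousP /(_ z Kz _ e20) [d d0 Hd] := cu.
    have Pz : (P z < (fine (u z) + e / 2)%:E)%E.
      by rewrite envelope_in// -{1}(fineK (ufin Kz)) lte_fin ltrDl.
    have /uscP /(_ z (KO Kz) _ Pz) [d' d'0 Hd'] := uP.
    exists (Num.min d d') => [|x y zx zy Kx Oy]; first by rewrite lt_min d0 d'0.
    have zx' : polydisc z d x by apply: polydisc_le zx; rewrite ge_min lexx.
    have zy' : polydisc z d' y by apply: polydisc_le zy; rewrite ge_min lexx orbT.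
    apply: (le_trans (ltW (Hd' y Oy zy'))); rewrite -(fineK (ufin Kx)) lee_fin.
    by have := Hd x Kx zx'; rewrite /= ltr_norml; lra.
  exists d; first exact: d0.
  by move=> x y Kx xy; exact: (Hd x y Kx xy Kx).
have [d3 d30 Hd3] : exists2 d : R, 0 < d & forall x y, K0 x -> polydisc x d y -> Omega y.
  apply: (@compact_uniform R n K0 (fun _ y => Omega y) cK0) => z K0z.
  have /nbhs_polydiscP [d d0 Hd] : nbhs z Omega.
    by apply: open_nbhs_nbhs; split => //; exact: K0O.
  by exists d => // x y _ zy; exact: Hd.
(* Half of the room [d3] around [K0] goes to the translation, the other half to the small discs on
   which the glued function is tested. *)
pose d := Num.min d1 (Num.min d2 (d3 / 2)).
have d0 : 0 < d by rewrite !lt_min d10 d20 divr_gt0.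
have dd1 : d <= d1 by rewrite ge_min lexx.
have dd2 : d <= d2 by rewrite !ge_min lexx !orbT.
have dd3 : d <= d3 / 2 by rewrite !ge_min lexx !orbT.
(* Here h - 2 e < b <= P at z, whereas P(z') <= h(z') < h(z) + e. *)
have off_K0 z z' : Omega z -> ~ K0 z -> Omega z' -> polydisc z d z' ->
    (P z' - (5 * e)%:E <= P z)%E.
  move=> Oz nK0z Oz' zz'.
  have bz : h2 z < b z by rewrite ltNge; apply/negP => bz; apply: nK0z; split => //; exact: sub.
  apply: le_trans (bP z Oz); apply: (@le_trans _ _ ((h z')%:E - (5 * e)%:E)%E).
    by apply: leeB => //; exact: Ph.
  rewrite -EFinB lee_fin.
  have := Hd1 z z' (sub _ Oz) (polydisc_le dd1 zz') (sub _ Oz').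
  by rewrite ltr_norml; move: bz; rewrite /h2; lra.
suff shift_le (w : Cvec R n) : (forall i, normc (w 0 i) < d) ->
    forall z, K0 z -> (P (z + w) - (5 * e)%:E <= P z)%E.
  exists d => // z z' Oz Oz' zz'; rewrite -leeBlDr//.
  have [K0z|nK0z] := pselect (K0 z); last exact: off_K0.
  have wd i : normc ((z' - z) 0 i) < d by rewrite !mxE; exact: zz'.
  by have := shift_le _ wd z K0z; rewrite (addrC z) subrK.
move=> wd.
have polyw z : polydisc z d (z + w) by move=> i; rewrite !mxE addrAC subrr add0r.
pose Q z := (P (z + w)%R - (5 * e)%:E)%E.
pose V z := if z \in K0 then maxe (P z) (Q z) else P z.
have Vin z : K0 z -> V z = maxe (P z) (Q z) by move=> K0z; rewrite /V mem_set.
have Vout z : ~ K0 z -> V z = P z by move=> K0z; rewrite /V memNset.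
have PV z : (P z <= V z)%E by rewrite /V; case: ifP => // _; rewrite le_max lexx.
(* The bound holds off [K0] too, by [off_K0]. It gives the mean value inequality on circles that
   leave [K0], where the definition of [V] no longer mentions [Q]. *)
have QV z : Omega z -> Omega (z + w) -> (Q z <= V z)%E.
  move=> Oz Ozw; have [K0z|nK0z] := pselect (K0 z); first by rewrite Vin// le_max lexx orbT.
  by rewrite Vout//; exact: off_K0.
have K0w z : K0 z -> Omega (z + w).
  move=> K0z; apply: (Hd3 z) => //; apply: polydisc_le (polyw z); lra.
have QF z : K0 z -> (Q z <= F z)%E.
  move=> K0z; have Oz := K0O _ K0z; have Ozw := K0w z K0z.
  have [Kz|nKz] := pselect (K z).
    rewrite glued_in// /Q leeBlDr//.
    apply: (le_trans (Hd2 z (z + w) Kz (polydisc_le dd2 (polyw z)) Ozw)).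
    by rewrite leeD2l// lee_fin; lra.
  rewrite glued_out//; apply: (@le_trans _ _ ((h (z + w))%:E - (5 * e)%:E)%E).
    by apply: leeB => //; exact: Ph.
  rewrite -EFinB lee_fin.
  have := Hd1 z (z + w) (sub _ Oz) (polydisc_le dd1 (polyw z)) (sub _ Ozw).
  by rewrite ltr_norml; lra.
have VF z : Omega z -> (V z <= F z)%E.
  move=> Oz; have [K0z|nK0z] := pselect (K0 z); last by rewrite Vout//; exact: le_envelope_glued.
  by rewrite Vin// ge_max le_envelope_glued//= QF.
suff pV : plurisubharmonic Omega V.
  move=> z K0z; apply: (@le_trans _ _ (V z)); first by apply: QV; [exact: K0O|exact: K0w].
  by apply: ereal_sup_ubound; exists V.
apply: (@plurisubharmonic_local R n Omega V (d3 / 2)); first exact: divr_gt0.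
- by move=> z Oz; apply: le_lt_trans (VF z Oz) _; apply: le_lt_trans (le_glued_h Oz) _; rewrite ltry.
- apply/uscP => z Oz a Va.
  have Pa : (P z < a%:E)%E by exact: le_lt_trans (PV z) Va.
  have /uscP /(_ z Oz a Pa) [r r0 Hr] := uP.
  (* Since [K0] is closed, V = P near a point off it. At a point of [K0] both P and Q lie below a,
     and nearby V is one of P and max(P, Q). *)
  have [K0z|nK0z] := pselect (K0 z); last first.
    have /nbhs_polydiscP [r' r'0 Hr'] : nbhs z (~` K0).
      by apply: open_nbhs_nbhs; split => //; exact: closed_openC.
    exists (Num.min r r') => [|x Ox zx]; first by rewrite lt_min r0 r'0.
    rewrite Vout; last by apply: Hr'; apply: polydisc_le zx; rewrite ge_min lexx orbT.
    by apply: Hr => //; apply: polydisc_le zx; rewrite ge_min lexx.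
  have Qa : (P (z + w) < (a + 5 * e)%:E)%E.
    rewrite EFinD -lteBlDr//; apply: le_lt_trans Va; apply: QV => //; exact: K0w.
  have /uscP /(_ _ (K0w z K0z) _ Qa) [r' r'0 Hr'] := uP.
  exists (Num.min r r') => [|x Ox zx]; first by rewrite lt_min r0 r'0.
  have zx1 : polydisc z r x by apply: polydisc_le zx; rewrite ge_min lexx.
  have zx2 : polydisc (z + w) r' (x + w).
    move=> i; rewrite !mxE opprD addrACA subrr addr0.
    by apply: (polydisc_le _ zx); rewrite ge_min lexx orbT.
  have [K0x|nK0x] := pselect (K0 x); last by rewrite Vout//; exact: Hr.
  rewrite Vin// gt_max Hr//= /Q lteBlDr// -EFinD.
  by apply: Hr' => //; exact: K0w.
- move=> z v r r0 zv vd.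
  have Oz : Omega z by have := zv 0; rewrite scale0r addr0 ComplexField.Normc.normc0; apply; exact: ltW.
  have PavgV : (P z <= avg (fun t => V (linear_circle z v r t)))%E.
    by apply: (le_trans (sP z v r r0 zv)); apply: le_avg => t _; exact: PV.
  have [K0z|nK0z] := pselect (K0 z); last by rewrite Vout.
  rewrite Vin// ge_max PavgV /=.
  have zwv : disc_in Omega (z + w) v r.
    move=> l lr; apply: (Hd3 z) => //; move=> i; rewrite !mxE.
    rewrite (_ : _ - z 0 i = w 0 i + l * v 0 i); last by ring.
    apply: (le_lt_trans (normcD_le _ _)); rewrite ComplexField.Normc.normcM.
    have := wd i; have := vd i.
    have : normc l * normc (v 0 i) <= r * normc (v 0 i) by rewrite ler_wpM2r ?normc_ge0.
    lra.
  have shiftE t : linear_circle (z + w) v r t = linear_circle z v r t + w.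
    by rewrite /linear_circle addrAC.
  apply: (@le_trans _ _ (avg (fun t => Q (linear_circle z v r t)))); last first.
    apply: le_avg => t _; apply: QV; first exact: disc_in_circle (ltW r0) zv.
    by rewrite -shiftE; exact: disc_in_circle (ltW r0) zwv.
  have := sP _ _ _ r0 zwv.
  under [in X in _ -> (_ <= X)%E]eq_fun do rewrite /Q -shiftE.
  rewrite (@avgB_cst R _ M).
  - by move=> sPz; rewrite /Q leeB.
  - apply: measurable_funTS; exact: measurable_linear_circle (ltW r0) uP zwv.
  - move=> t; have Ot := disc_in_circle t (ltW r0) zwv.
    by apply: (le_trans (Ph _ Ot)); rewrite lee_fin; exact/hM/sub.
Qed.

End Envelope.

Theorem theorem2p6 (R : realType) (n : nat) (Omega Omega' : set (Cvec R n))
  (h : Cvec R n -> R) (u : Cvec R n -> \bar R) :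
  B_regular Omega ->
  domain Omega' ->
  relatively_compact Omega' Omega ->
  interior_ball_condition Omega' ->
  {within closure Omega, continuous h} ->
  plurisubharmonic Omega u ->
  (forall z, Omega z -> (u z <= (h z)%:E)%E) ->
  continuous_real_on (closure Omega') u ->
  continuous_real_on Omega (Perron_Bremermann Omega (glued h u Omega')).
Proof.
move=> rO [oO' _ [z1 O'z1]] [cK KO] ballO' ch pu uh [ufin cu].
have Kz1 := @subset_closure _ Omega' _ O'z1.
(* The barrier relies on a first coordinate. In dimension 0 the space is a single point, which lies
   in Omega', so the envelope equals u there. *)
case: n Omega Omega' h u rO oO' z1 O'z1 cK KO ballO' ch pu uh ufin cu Kz1
  => [|m] Omega Omega' h u rO oO' z1 O'z1 cK KO ballO' ch pu uh ufin cu Kz1.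
  have all_eq (z w : Cvec R 0) : z = w by apply/matrixP => i [].
  split.
    by move=> z _; rewrite (all_eq z z1) envelope_in//; exact: ufin.
  apply/within_continuousP => z _ e e0; exists 1 => // w _ _.
  by rewrite (all_eq w z) subrr normr0.
have [[oO _ _] bO _] := rO.
have [M uM] : exists M : R, forall z, closure Omega' z -> (- M%:E <= u z)%E.
  have cNu : {within closure Omega', continuous (fun z => 0 + -1 * fine (u z))}.
    by apply: within_continuous_lin => //; apply: continuous_subspaceT; exact: cst_continuous.
  have [M uM] := usc_bounded cK (within_continuous_usc cNu) (fun z _ => ltry _).
  exists M => z Kz; have := uM z Kz; rewrite -(fineK (ufin z Kz)) /= !lee_fin; lra.
have FM z : closure Omega' z -> ((- M)%:E <= glued h u Omega' z)%E.
  by move=> Kz; rewrite glued_in// EFinN; exact: uM.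
have Fh z : Omega z -> ~ closure Omega' z -> glued h u Omega' z = (h z)%:E.
  by move=> _; exact: glued_out.
set P := Perron_Bremermann _ _.
have Pfin z : Omega z -> P z \is a fin_num.
  (* Any barrier bounds the envelope below by a real function; the tolerance 1 is arbitrary. *)
  move=> Oz; have [b [pb _ bF _]] := envelope_barrier rO ch cK KO Fh FM ltr01.
  have bP : ((b z)%:E <= P z)%E by apply: ereal_sup_ubound; exists (EFin \o b).
  have Ph : (P z <= (h z)%:E)%E.
    apply: (@le_trans _ _ (glued h u Omega' z)); first exact: le_envelope_glued.
    by apply: le_glued_h; [exact: uh|exact: Oz].
  by rewrite fin_numE; move: bP Ph; case: (P z).
split=> //; apply/within_continuousP => z Oz e e0.
(* The uniform estimate loses five times its tolerance, and 5 e / 6 < e. It is applied in both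
   orders of the two points. *)
have e60 : 0 < e / 6 by rewrite divr_gt0.
have [b [pb cb bF bh]] := envelope_barrier rO ch cK KO Fh FM e60.
have [d d0 Hd] := envelope_uniformly_continuous oO bO oO' cK KO ballO' ch pu uh ufin cu e60 pb cb bF bh.
exists d => // w Ow zw.
have := Hd z w Oz Ow zw; have := Hd w z Ow Oz (polydisc_sym zw).
rewrite -/P -(fineK (Pfin z Oz)) -(fineK (Pfin w Ow)) -!EFinD !lee_fin /= ltr_norml.
lra.
Qed.
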